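(* Let $\mathbb{K}$ be an algebraically closed field of characteristic $0$. The realization space $\mathcal{R}_5$ (over $\mathbb{K}$) is birational to the modular elliptic surface $\Xi_1(5)$. The operator $\Psi_{\{2\}}^{0}$ acts on $\Xi_1(5)$ as the map $(E,p,t)\mapsto(E,[-2]p,[-2]t)$.
   Context: Modular surface: $\Xi_1(5)$ is the elliptic modular surface over the modular curve $X_1(5)$: the minimal smooth compactification of the surface parametrizing triples $(E,p,t)$, where $E$ is an elliptic curve, $p\in E$ and $t\in E$ is a point of order $5$. Multiplication by $m$ on $E$ is denoted $[m]$. The matroid $M_5$: the rank $3$ matroid with ground set the disjoint union of two copies of $\mathbb{Z}/5\mathbb{Z}$ whose non-bases are exactly the triples $\{i,j;r\}$ with $i\ne j$ in the first copy, $r$ in the second copy and $i+j+r=0$ in $\mathbb{Z}/5\mathbb{Z}$. A realization is a labeled line arrangement of $10$ lines in $\mathbb{P}^2$ in which three lines are concurrent if and only if their labels form a non-basis; $\mathcal{R}_5=\mathcal{R}(M_5)$ parametrizes realizations modulo $\mathrm{PGL}_3$. (A realization is determined, via the incidences, by its first five lines.) Operators: for a labeled pentagon $\mathcal{C}_0=(\ell_1,\dots,\ell_5)$ (labeled arrangement of $5$ lines, indices in $\mathbb{Z}/5\mathbb{Z}$), let $p_{i,j}=\ell_i\cap\ell_j$ and let $\Lambda_{\{2\}}^{0}(\mathcal{C}_0)=(\ell_1',\dots,\ell_5')$ with $$\ell_1'=\overline{p_{3,4}p_{2,5}},\ \ell_2'=\overline{p_{1,3}p_{4,5}},\ \ell_3'=\overline{p_{1,5}p_{2,4}},\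 \ell_4'=\overline{p_{1,2}p_{3,5}},\ \ell_5'=\overline{p_{1,4}p_{2,3}},$$ where $\overline{pq}$ is the line through $p\ne q$. Let $\mathcal{D}$ be the dual operator exchanging a point $(a:b:c)$ and the line $\{ax+by+cz=0\}$, and $\Psi_{\{2\}}^{0}=\mathcal{D}\circ\Lambda_{\{2\}}^{0}\circ\mathcal{D}$, acting on labeled arrangements of $5$ points. Action on $\Xi_1(5)$: to a triple $(E,p,t)$, with $E$ embedded as a smooth plane cubic with the neutral element at a flex, one associates the labeled point arrangement $(p+jt)_{j\in\mathbb{Z}/5\mathbb{Z}}$, modulo projective transformations. The statement that $\Psi^0_{\{2\}}$ acts as $(E,p,t)\mapsto(E,[-2]p,[-2]t)$ is understood through this association, for generic triples. *)

(* Defs.v *)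
(* MathComp (with multinomials). *)
From mathcomp Require Import all_boot all_order all_algebra.
From mathcomp Require Export mpoly.

Set Implicit Arguments.
Unset Strict Implicit.
Unset Printing Implicit Defensive.

Import GRing.Theory.
Local Open Scope ring_scope.

(** * Varieties as spaces with functions *)

(* The quotient of a subset [pts] of an affine space by a relation [eqv].  It is
   regarded as a space with functions: the open sets and the regular functions
   of the quotient are those whose pullbacks to [pts] are open and regular for
   the Zariski topology.  Subsets of the quotient are encoded by [eqv]-saturated
   subsets of [pts], and functions on them by [eqv]-invariant functions. *)
Record qspace (K : fieldType) := QSpace {
  car : Type;
  dim : nat;
  coord : car -> 'rV[K]_dim;
  pts : car -> Prop;
  eqv : car -> car -> Prop
}.

Definition pev (K : fieldType) (X : qspace K) (f : {mpoly K[dim X]})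
  (x : car X) : K := f.@[fun i => coord x 0 i].

Definition zopen (K : fieldType) (X : qspace K) (U : car X -> Prop) : Prop :=
  [/\ forall x, U x -> pts x,
      forall x y, U x -> pts y -> eqv x y -> U y
    & forall x, U x -> exists2 d : {mpoly K[dim X]}, pev d x != 0 &
        forall y, pts y -> pev d y != 0 -> U y].

Definition dense_open (K : fieldType) (X : qspace K) (U : car X -> Prop) : Prop :=
  zopen U /\
  forall O : car X -> Prop, zopen O -> (exists x, O x) -> exists2 x, O x & U x.

Definition regular (K : fieldType) (X : qspace K) (U : car X -> Prop)
  (h : car X -> K) : Prop :=
  (forall x y, U x -> U y -> eqv x y -> h x = h y) /\
  (forall x, U x -> exists n d : {mpoly K[dim X]}, pev d x != 0 /\
     forall y, U y -> pev d y != 0 -> h y = pev n y / pev d y).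

(* [f] is only a set-theoretic lift of the map of quotients: it is the induced
   map which is required to be continuous and to pull back regular functions to
   regular functions. *)
Definition is_morphism (K : fieldType) (X Y : qspace K)
  (U : car X -> Prop) (V : car Y -> Prop) (f : car X -> car Y) : Prop :=
  [/\ forall x, U x -> V (f x),
      forall x x', U x -> U x' -> eqv x x' -> eqv (f x) (f x')
    & forall O : car Y -> Prop, zopen O -> (forall y, O y -> V y) ->
        zopen (fun x => U x /\ O (f x)) /\
        forall h, regular O h ->
          regular (fun x => U x /\ O (f x)) (fun x => h (f x))].

Definition isomorphic (K : fieldType) (X Y : qspace K)
  (U : car X -> Prop) (V : car Y -> Prop) : Prop :=
  exists (f : car X -> car Y) (g : car Y -> car X),
    [/\ is_morphism U V f, is_morphism V U g,
        forall x, U x -> eqv (g (f x)) x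
      & forall y, V y -> eqv (f (g y)) y].

Definition birational (K : fieldType) (X Y : qspace K) : Prop :=
  exists (U : car X -> Prop) (V : car Y -> Prop),
    [/\ dense_open U, dense_open V & isomorphic U V].

Definition proj_variety (K : fieldType) (n : nat)
  (I : {mpoly K[n]} -> Prop) : qspace K :=
  @QSpace K 'rV[K]_n n id
    (fun v => v != 0 /\ forall f, I f -> f.@[fun i => v 0 i] = 0)
    (fun v w => exists2 c : K, c != 0 & w = c *: v).

Definition compactification (K : fieldType) (X : qspace K) (n : nat)
  (I : {mpoly K[n]} -> Prop) : Prop :=
  (forall f, I f -> exists d : nat, f \is d.-homog) /\
  exists2 W : car (proj_variety I) -> Prop,
    dense_open W & isomorphic (@pts K X) W.

(** * Arrangements in the projective plane *)

(* A point (a:b:c), or a line ax+by+cz=0, is a nonzero vector up to scaling. *)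

Definition arr_equiv (K : fieldType) (T : Type) (A B : T -> 'rV[K]_3) : Prop :=
  exists2 g : 'M[K]_3, g \in unitmx &
    forall i, exists2 c : K, c != 0 & B i = c *: (A i *m g).

(* The line through two points, and also the common point of two lines.  It is
   0 exactly when it is undefined, that is, when the two arguments are
   proportional (in particular when one of them is itself undefined). *)
Definition cross (K : fieldType) (u v : 'rV[K]_3) : 'rV[K]_3 :=
  let x (w : 'rV[K]_3) (k : nat) := w 0 (inord k) in
  \row_(i < 3) nth 0 [:: x u 1%N * x v 2%N - x u 2%N * x v 1%N;
                         x u 2%N * x v 0%N - x u 0%N * x v 2%N;
                         x u 0%N * x v 1%N - x u 1%N * x v 0%N] i.

Definition on_line (K : fieldType) (p l : 'rV[K]_3) : Prop :=
  \sum_(i < 3) p 0 i * l 0 i = 0.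

Definition concurrent (K : fieldType) (l m n : 'rV[K]_3) : Prop :=
  exists2 p : 'rV[K]_3, p != 0 & [/\ on_line p l, on_line p m & on_line p n].

Definition pentagon (K : fieldType) : Type := 'Z_5 -> 'rV[K]_3.

(* The line labelled 5 has index 5 = 0 in Z/5Z and therefore comes first. *)
Definition Lambda (K : fieldType) (l : pentagon K) : pentagon K :=
  let p (i j : 'Z_5) := cross (l i) (l j) in
  fun i => nth 0 [:: cross (p 1 4) (p 2 3);
                     cross (p 3 4) (p 2 5);
                     cross (p 1 3) (p 4 5);
                     cross (p 1 5) (p 2 4);
                     cross (p 1 2) (p 3 5)] (i : 'I_5).

(* A point and its dual line have the same coordinate vector. *)
Definition dual_op (K : fieldType) (A : pentagon K) : pentagon K := A.

Definition Psi (K : fieldType) (P : pentagon K) : pentagon K :=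
  dual_op (Lambda (dual_op P)).

(** * The matroid M_5 and its realization space *)

Definition label : finType := ('Z_5 + 'Z_5)%type.

Definition M5_nonbasis (A : {set label}) : bool :=
  [exists i : 'Z_5, exists j : 'Z_5, exists r : 'Z_5,
    [&& i != j, i + j + r == 0 & A == [set inl i; inl j; inr r]]].

Definition realization (K : fieldType) (L : label -> 'rV[K]_3) : Prop :=
  (forall a b, a != b -> cross (L a) (L b) != 0) /\
  (forall a b c, a != b -> b != c -> a != c ->
     concurrent (L a) (L b) (L c) <-> M5_nonbasis [set a; b; c]).

Definition R5 (K : fieldType) : qspace K :=
  @QSpace K (label -> 'rV[K]_3) _
    (fun L => row_mx (mxvec (\matrix_(i < 5) L (inl i)))
                     (mxvec (\matrix_(i < 5) L (inr i))))
    (@realization K) (@arr_equiv K label).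

(** * Elliptic curves *)

(* Weierstrass equation y^2 + a1 xy + a3 y = x^3 + a2 x^2 + a4 x + a6; the
   neutral element is the flex (0:1:0). *)
Record wcurve (K : fieldType) := WCurve { a1 : K; a2 : K; a3 : K; a4 : K; a6 : K }.

Definition wdisc (K : fieldType) (E : wcurve K) : K :=
  let b2 := a1 E ^+ 2 + 4 * a2 E in
  let b4 := 2 * a4 E + a1 E * a3 E in
  let b6 := a3 E ^+ 2 + 4 * a6 E in
  let b8 := a1 E ^+ 2 * a6 E + 4 * a2 E * a6 E - a1 E * a3 E * a4 E
            + a2 E * a3 E ^+ 2 - a4 E ^+ 2 in
  - b2 ^+ 2 * b8 - 8 * b4 ^+ 3 - 27 * b6 ^+ 2 + 9 * b2 * b4 * b6.

Definition weq (K : fieldType) (E : wcurve K) (x y z : K) : K :=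
  y ^+ 2 * z + a1 E * x * y * z + a3 E * y * z ^+ 2
  - (x ^+ 3 + a2 E * x ^+ 2 * z + a4 E * x * z ^+ 2 + a6 E * z ^+ 3).

(* Points of a Weierstrass curve: [None] is the neutral element. *)
Definition wpoint (K : fieldType) : Type := option (K * K).

Definition wneg (K : fieldType) (E : wcurve K) (P : wpoint K) : wpoint K :=
  if P is Some (x, y) then Some (x, - y - a1 E * x - a3 E) else None.

Definition wadd (K : fieldType) (E : wcurve K) (P Q : wpoint K) : wpoint K :=
  match P, Q with
  | None, _ => Q
  | _, None => P
  | Some (x1, y1), Some (x2, y2) =>
    if (x1 == x2) && (y1 + y2 + a1 E * x2 + a3 E == 0) then None else
    let s := if x1 == x2
             then (3 * x1 ^+ 2 + 2 * a2 E * x1 + a4 E - a1 E * y1)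
                  / (2 * y1 + a1 E * x1 + a3 E)
             else (y2 - y1) / (x2 - x1) in
    let x3 := s ^+ 2 + a1 E * s - a2 E - x1 - x2 in
    Some (x3, - (s * (x3 - x1) + y1) - a1 E * x3 - a3 E)
  end.

Definition wmul (K : fieldType) (E : wcurve K) (m : nat) (P : wpoint K) :
  wpoint K := iter m (wadd E P) None.

Definition vec_of (K : fieldType) (P : wpoint K) : 'rV[K]_3 :=
  \row_(i < 3) nth 0 (if P is Some (x, y) then [:: x; y; 1] else [:: 0; 1; 0]) i.

(* The converse, for a nonzero vector satisfying the Weierstrass equation: such
   a vector with z = 0 is proportional to (0:1:0). *)
Definition point_of (K : fieldType) (v : 'rV[K]_3) : wpoint K :=
  let x := v 0 (inord 0) in let y := v 0 (inord 1) in let z := v 0 (inord 2) in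
  if z == 0 then None else Some (x / z, y / z).

(** * The elliptic modular surface *)

Record triple (K : fieldType) :=
  Triple { tcurve : wcurve K; tpoint : 'rV[K]_3; ttors : 'rV[K]_3 }.

Definition on_curve (K : fieldType) (E : wcurve K) (v : 'rV[K]_3) : Prop :=
  v != 0 /\ weq E (v 0 (inord 0)) (v 0 (inord 1)) (v 0 (inord 2)) = 0.

Definition is_triple (K : fieldType) (T : triple K) : Prop :=
  [/\ wdisc (tcurve T) != 0, on_curve (tcurve T) (tpoint T), on_curve (tcurve T) (ttors T),
      point_of (ttors T) != None & wmul (tcurve T) 5 (point_of (ttors T)) = None].

Definition wchange (K : fieldType) (u r s w : K) (P : wpoint K) : wpoint K :=
  if P is Some (x, y)
  then Some (u ^+ 2 * x + r, u ^+ 3 * y + s * u ^+ 2 * x + w) else None.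

(* Isomorphism of triples: an admissible change of Weierstrass coordinates
   matching the equations and the marked points. *)
Definition triple_iso (K : fieldType) (T T' : triple K) : Prop :=
  exists u r s w : K,
    [/\ u != 0,
        forall x y, weq (tcurve T) (u ^+ 2 * x + r) (u ^+ 3 * y + s * u ^+ 2 * x + w) 1
                    = u ^+ 6 * weq (tcurve T') x y 1,
        point_of (tpoint T) = wchange u r s w (point_of (tpoint T'))
      & point_of (ttors T) = wchange u r s w (point_of (ttors T'))].

(* The surface parametrizing the triples (E,p,t), a dense open subset of the
   elliptic modular surface over X_1(5). *)
Definition Xi1_5_open (K : fieldType) : qspace K :=
  @QSpace K (triple K) _
    (fun T => row_mx (\row_(i < 5) nth 0 [:: a1 (tcurve T); a2 (tcurve T); a3 (tcurve T);
                                             a4 (tcurve T); a6 (tcurve T)] i)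
                     (row_mx (tpoint T) (ttors T)))
    (@is_triple K) (@triple_iso K).

Definition triple_points (K : fieldType) (T : triple K) : pentagon K :=
  fun j => vec_of (wadd (tcurve T) (point_of (tpoint T))
                        (wmul (tcurve T) (j : 'I_5) (point_of (ttors T)))).

Definition triple_mulN2 (K : fieldType) (T : triple K) : triple K :=
  let m v := vec_of (wneg (tcurve T) (wmul (tcurve T) 2 (point_of v))) in
  Triple (tcurve T) (m (tpoint T)) (m (ttors T)).

(* Main.v *)
From Pilot Require Import Defs.
From mathcomp Require Import all_boot all_order all_algebra.
From mathcomp Require Import ring.

(** Both the realization space and the surface of triples are rational, and the
    birational map between them goes through the affine plane.

    A realization is determined by its first five lines: the labels i, j with
    i + j + r = 0 form two disjoint pairs, and the line r must join the two
    double points of these pairs. No three of the five lines are concurrent, so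
    they have a unique projective normal form (1:0:0), (0:1:0), (0:0:1), (1:1:1),
    (u:v:1). Thus (u, v) identifies the realization space with the set of the
    points of the plane where finitely many polynomials do not vanish
    ([real_planeE]); it contains (2, 3).

    A curve with a point t of order 5 has a unique equation in Tate's form
    y^2 + (1 - b) x y - b y = x^3 - b x^2 with t = (0, 0) ([tate_normal_form],
    [tate_rigid]). This equation is linear in b, so that b is a rational function
    of the coordinates (x, y) of p, and these coordinates identify the triples
    for which p is neither 0 nor t with an open subset of the plane. The missing
    triples are limits of such triples on the same curve, because every component
    of a plane curve monic in one coordinate dominates the axis of the other
    ([monic_curve_dense], [in_chart_dense]).

    The action of the operator can be computed in Tate's form, since it commutes
    with projective transformations ([Psi_equiv], [triple_points_iso]). The new
    vertex m is the meet of the lines joining p + (m + i) t and p + (m - i) t for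
    i = 1, 2. The sum of these two points is 2(p + mt), so both lines contain
    -2(p + mt) = -2p + m (-2t), which is the point m of the image triple. With
    explicit formulas for the translation by t and for -2P, this reduces to three
    identities in the coordinates of one point of the curve
    ([neg_dbl_collinear1], [neg_dbl_collinear2], [wadd_neg_dbl]). They hold where
    finitely many functions do not vanish, and none of these vanishes at the point
    (3, 3) of the curve with b = -3 ([generic_plane_inhabited]). *)

Set Implicit Arguments.
Unset Strict Implicit.
Unset Printing Implicit Defensive.

Import Pilot.Defs GRing.Theory.
Local Open Scope ring_scope.

(** * Spaces with functions *)

Section SpacesWithFunctions.
Variable K : fieldType.
Implicit Types X Y Z : qspace K.

Notation eqv_rel X := (RelationClasses.Equivalence (@eqv K X)).

Lemma zopen_ext X (U U' : car X -> Prop) :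
  (forall x, U x <-> U' x) -> zopen U -> zopen U'.
Proof.
move=> UU' [Upts Usat Unbh]; split=> [x /UU'|x y /UU' Ux py xy|x /UU'/Unbh].
- exact: Upts.
- exact/UU'/(Usat x).
- by case=> d dx dU; exists d => // y py /(dU y py)/UU'.
Qed.

Lemma zopen_pts X : zopen (@pts K X).
Proof. by split=> // x px; exists 1; rewrite /pev ?meval1 ?oner_eq0. Qed.

Lemma zopenI X (U V : car X -> Prop) :
  zopen U -> zopen V -> zopen (fun x => U x /\ V x).
Proof.
move=> [Up Us Un] [Vp Vs Vn]; split=> [x [/Up]|x y [Ux Vx] py xy|x [Ux Vx]] //.
  by split; [apply: Us xy | apply: Vs xy].
have [d dx dU] := Un x Ux; have [e ex eV] := Vn x Vx.
exists (d * e); first by rewrite /pev mevalM mulf_neq0.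
move=> y py; rewrite /pev mevalM.
by rewrite mulf_eq0 negb_or => /andP[dy ey]; split; [apply: dU | apply: eV].
Qed.

Lemma regular_sub X (U V : car X -> Prop) h :
  (forall x, V x -> U x) -> regular U h -> regular V h.
Proof.
move=> VU [hs hn]; split=> [x y /VU Ux /VU Uy|x /VU/hn]; first exact: hs.
by case=> n [d [dx E]]; exists n, d; split=> // y /VU; apply: E.
Qed.

Lemma morphism_restrict X Y (U : car X -> Prop) (V O : car Y -> Prop) f :
  is_morphism U V f -> (forall y, O y -> V y) ->
  is_morphism (fun x => U x /\ O (f x)) O f.
Proof.
move=> [fUV feq fO] OV; split=> [x []|x x' [Ux _] [Ux' _]|O' zO' O'O] //.
  exact: feq.
have [zP rP] := fO O' zO' (fun y Oy => OV y (O'O y Oy)); split.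
  apply: zopen_ext zP => x; split=> [[Ux O'x]|[[Ux _] O'x]] //.
  by do !split=> //; apply: O'O.
by move=> h /rP; apply: regular_sub => x [[Ux _] O'x].
Qed.

Lemma morphism_comp X Y Z (U : car X -> Prop) (V : car Y -> Prop)
    (W : car Z -> Prop) f g :
  is_morphism U V f -> is_morphism V W g -> is_morphism U W (fun x => g (f x)).
Proof.
move=> [fUV feq fO] [gVW geq gO]; split=> [x Ux|x x' Ux Ux' xx'|O zO OW].
- exact/gVW/fUV.
- by apply: geq; [apply: fUV | apply: fUV | apply: feq].
have [zP rP] := gO O zO OW.
have [zQ rQ] := fO _ zP (fun y (Py : V y /\ _) => let: conj Vy _ := Py in Vy).
split; last first.
  by move=> h /rP/rQ; apply: regular_sub => x [Ux Ox]; do !split=> //; apply: fUV.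
apply: zopen_ext zQ => x; split=> [[Ux [_ Ox]]|[Ux Ox]] //.
by do !split=> //; apply: fUV.
Qed.

(** Dense open subsets are compared through an isomorphism by moving the open set
    to be met to the other side. *)
Lemma dense_open_preimage X Y (U : car X -> Prop) (V V' : car Y -> Prop) f g :
    eqv_rel X -> eqv_rel Y -> dense_open U -> zopen V ->
    is_morphism U V f -> is_morphism V U g ->
    (forall x, U x -> eqv (g (f x)) x) -> (forall y, V y -> eqv (f (g y)) y) ->
  dense_open V' -> dense_open (fun x => U x /\ (V (f x) /\ V' (f x))).
Proof.
move=> eqX eqY [zU dU] zV [fUV feq fO] [gVU geq gO] gf fg [zV' dV'].
have zVV' := zopenI zV zV'; have [VVp VVs _] := zVV'.
have [zP _] := fO _ zVV' (fun y (Py : V y /\ _) => let: conj Vy _ := Py in Vy).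
split=> // O zO /(dU O zO)[x Ox Ux].
have zOU := zopenI zO zU; have [OUp OUs _] := zOU.
have [zQ _] := gO _ zOU (fun y (Py : _ /\ U y) => let: conj _ Uy := Py in Uy).
have [_ symX _] := eqX; have [_ symY _] := eqY.
have [Up _ _] := zU; have [Vp Vs _] := zV; have [_ V's _] := zV'.
case: (dV' _ zQ) => [|y [Vy [Oy Uy]] V'y].
  exists (f x); split; first exact: fUV.
  by apply: (OUs x) => //; [apply/Up/gVU/fUV | apply/symX/gf].
exists (g y) => //; split=> //; apply: (VVs y) => //.
  exact/Vp/fUV.
exact/symY/fg.
Qed.

Lemma birational_sym X Y : birational X Y -> birational Y X.
Proof.
move=> [U [V [dU dV [f [g [mf mg gf fg]]]]]].
by exists V, U; split=> //; exists g, f.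
Qed.

(** Two isomorphisms of open subsets compose over the intersection of their open
    subsets of the middle space; density passes to both ends through
    [dense_open_preimage]. *)
Lemma birational_trans X Y Z :
    eqv_rel X -> eqv_rel Y -> eqv_rel Z ->
  birational X Y -> birational Y Z -> birational X Z.
Proof.
move=> eqX eqY eqZ [U [V [dU dV [f [g [mf mg gf fg]]]]]].
move=> [V' [W [dV' dW [f' [g' [mf' mg' gf' fg']]]]]].
have [zV _] := dV; have [zV' _] := dV'.
have [fUV _ _] := mf; have [gVU geq _] := mg.
have [f'V'W f'eq _] := mf'; have [g'WV' _ _] := mg'.
have [_ _ trX] := eqX; have [_ symY _] := eqY; have [_ _ trZ] := eqZ.
have [Vp Vs _] := zV; have [V'p V's _] := zV'.
pose M y := V y /\ V' y.
have VVM: forall y z, M y -> pts z -> eqv y z -> M z.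
  by move=> y z [Vy V'y] pz yz; split; [apply: Vs yz | apply: V's yz].
exists (fun x => U x /\ M (f x)), (fun z => W z /\ M (g' z)); split.
- exact: dense_open_preimage mf mg gf fg dV'.
- have := dense_open_preimage eqZ eqY dW zV' mg' mf' fg' gf' dV.
  case=> zP dP; split; first by apply: zopen_ext zP => z; split=> -[Wz [? ?]].
  by move=> O zO /(dP O zO)[z Oz [Wz [? ?]]]; exists z.
have mf1 : is_morphism (fun x => U x /\ M (f x)) M f.
  by apply: morphism_restrict mf _ => y [].
have mg1 : is_morphism (fun z => W z /\ M (g' z)) M g'.
  by apply: morphism_restrict mg' _ => y [].
have Mgf y : M y -> M (f (g y)).
  by case=> Vy V'y; apply: (VVM y); [split | apply/Vp/fUV/gVU | apply/symY/fg].
have Mfg y : M y -> M (g' (f' y)).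
  by case=> Vy V'y; apply: (VVM y); [split | apply/V'p/g'WV'/f'V'W | apply/symY/gf'].
have mg2 : is_morphism M (fun x => U x /\ M (f x)) g.
  have [_ _ gO] := mg; split=> [y My|y y' [Vy _] [Vy' _]|O zO OU].
  - by split; [apply/gVU/My.1 | apply: Mgf].
  - exact: geq.
  have [zP rP] := gO O zO (fun x Ox => (OU x Ox).1); split.
    apply: zopen_ext (zopenI zP zV') => y.
    by split=> [[[Vy Oy] V'y]|[[Vy V'y] Oy]].
  by move=> h /rP; apply: regular_sub => y [[]].
have mf2 : is_morphism M (fun z => W z /\ M (g' z)) f'.
  have [_ _ fO] := mf'; split=> [y My|y y' [_ Vy] [_ Vy']|O zO OU].
  - by split; [apply/f'V'W/My.2 | apply: Mfg].
  - exact: f'eq.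
  have [zP rP] := fO O zO (fun x Ox => (OU x Ox).1); split.
    apply: zopen_ext (zopenI zP zV) => y.
    by split=> [[[Vy Oy] V'y]|[[Vy V'y] Oy]].
  by move=> h /rP; apply: regular_sub => y [[]].
exists (fun x => f' (f x)), (fun z => g (g' z)); split.
- exact: morphism_comp mf1 mf2.
- exact: morphism_comp mg1 mg2.
- move=> x [Ux [Vx V'x]].
  apply: (trX _ (g (f x))); last exact: gf.
  by apply: geq => //; [case: (Mfg (f x)) | apply: gf'].
- move=> z [Wz [Vz V'z]].
  apply: (trZ _ (f' (g' z))); last exact: fg'.
  by apply: f'eq => //; [case: (Mgf (g' z)) | apply: fg].
Qed.

(** The local condition on regular functions without the invariance under the
    equivalence relation: it is stable under the operations with which formulas
    are written. *)
Definition lregular X (U : car X -> Prop) (h : car X -> K) : Prop :=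
  forall x, U x -> exists n d : {mpoly K[dim X]}, pev d x != 0 /\
    forall y, U y -> pev d y != 0 -> h y = pev n y / pev d y.

Section LocallyRegular.
Variables (X : qspace K) (U : car X -> Prop).
Implicit Types h k : car X -> K.

Lemma lregular_ext h k : (forall x, U x -> h x = k x) -> lregular U h -> lregular U k.
Proof.
move=> hk rh x /rh[n [d [dx E]]]; exists n, d; split=> // y Uy dy.
by rewrite -hk // E.
Qed.

Lemma lregularC c : lregular U (fun=> c).
Proof.
move=> x Ux; exists c%:MP, 1; rewrite /pev meval1 oner_eq0; split=> // y _ _.
by rewrite mevalC meval1 divr1.
Qed.

Lemma lregular_coord i : lregular U (fun x => coord x 0 i).
Proof.
move=> x Ux; exists 'X_i, 1; rewrite /pev meval1 oner_eq0; split=> // y _ _.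
by rewrite mevalXU meval1 divr1.
Qed.

Lemma lregularD h k : lregular U h -> lregular U k -> lregular U (fun x => h x + k x).
Proof.
move=> rh rk x Ux; have [n [d [dx E]]] := rh x Ux; have [m [e [ex F]]] := rk x Ux.
exists (n * e + m * d), (d * e); rewrite /pev mevalM mulf_neq0 //; split=> // y Uy.
rewrite mevalD !mevalM mulf_eq0 negb_or => /andP[dy ey].
by rewrite E // F // addf_div.
Qed.

Lemma lregularM h k : lregular U h -> lregular U k -> lregular U (fun x => h x * k x).
Proof.
move=> rh rk x Ux; have [n [d [dx E]]] := rh x Ux; have [m [e [ex F]]] := rk x Ux.
exists (n * m), (d * e); rewrite /pev mevalM mulf_neq0 //; split=> // y Uy.
rewrite !mevalM mulf_eq0 negb_or => /andP[dy ey].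
by rewrite E // F // mulf_div.
Qed.

Lemma lregularN h : lregular U h -> lregular U (fun x => - h x).
Proof.
move=> rh x Ux; have [n [d [dx E]]] := rh x Ux.
by exists (- n), d; split=> // y Uy dy; rewrite E // /pev mevalN mulNr.
Qed.

Lemma lregularX h m : lregular U h -> lregular U (fun x => h x ^+ m).
Proof.
move=> rh; elim: m => [|m IH]; first exact: lregularC.
by apply: lregular_ext (lregularM rh IH) => x _; rewrite exprS.
Qed.

Lemma lregularV h : (forall x, U x -> h x != 0) ->
  lregular U h -> lregular U (fun x => (h x)^-1).
Proof.
move=> h0 rh x Ux; have [n [d [dx E]]] := rh x Ux.
have nx: pev n x != 0.
  by apply: contraNneq (h0 x Ux) => nx; rewrite E // nx mul0r.
exists (d * d), (d * n); rewrite /pev mevalM mulf_neq0 //; split=> // y Uy.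
rewrite !mevalM mulf_eq0 negb_or => /andP[dy ny]; rewrite E // invf_div.
by rewrite -mulf_div divff ?mul1r.
Qed.

Lemma lregular_sum (I : Type) (r : seq I) (h : I -> car X -> K) :
  (forall i, lregular U (h i)) -> lregular U (fun x => \sum_(i <- r) h i x).
Proof.
move=> rh; elim: r => [|i r IH].
  by apply: lregular_ext (lregularC 0) => x _; rewrite big_nil.
by apply: lregular_ext (lregularD (rh i) IH) => x _; rewrite big_cons.
Qed.

Lemma lregular_prod (I : Type) (r : seq I) (h : I -> car X -> K) :
  (forall i, lregular U (h i)) -> lregular U (fun x => \prod_(i <- r) h i x).
Proof.
move=> rh; elim: r => [|i r IH].
  by apply: lregular_ext (lregularC 1) => x _; rewrite big_nil.
by apply: lregular_ext (lregularM (rh i) IH) => x _; rewrite big_cons.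
Qed.

Lemma lregular_meval m (p : {mpoly K[m]}) (h : 'I_m -> car X -> K) :
  (forall i, lregular U (h i)) -> lregular U (fun x => p.@[fun i => h i x]).
Proof.
move=> rh.
suff: lregular U (fun x => \sum_(w <- msupp p) p@_w * \prod_i h i x ^+ w i).
  by apply: lregular_ext => x _; rewrite mevalE.
apply: lregular_sum => w; apply: lregularM; first exact: lregularC.
by apply: lregular_prod => i; apply: lregularX.
Qed.

Lemma zopen_neq0 h : zopen U -> lregular U h ->
    (forall x y, U x -> U y -> eqv x y -> h x = h y) ->
  zopen (fun x => U x /\ h x != 0).
Proof.
move=> [Up Us Un] rh heq; split=> [x [/Up]|x y [Ux hx] py xy|x [Ux hx]] //.
  have Uy: U y by apply: Us xy.
  by rewrite -(heq x).
have [e ex eU] := Un x Ux; have [n [d [dx E]]] := rh x Ux.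
exists (e * (d * n)).
  rewrite /pev !mevalM !mulf_neq0 //.
  by apply: contraNneq hx => nx; rewrite E // /pev nx mul0r.
move=> y py; rewrite /pev !mevalM !mulf_eq0 !negb_or => /and3P[ey dy ny].
have Uy := eU y py ey; split=> //.
by rewrite E // mulf_neq0 // invr_neq0.
Qed.

End LocallyRegular.

(** A map given by local fractions is a morphism: pulling back a polynomial or a
    fraction is substitution. *)
Lemma lregular_morphism X Y (U : car X -> Prop) (V : car Y -> Prop) f :
    zopen U -> (forall y, V y -> pts y) -> (forall x, U x -> V (f x)) ->
    (forall x x', U x -> U x' -> eqv x x' -> eqv (f x) (f x')) ->
    (forall i, lregular U (fun x => coord (f x) 0 i)) ->
  is_morphism U V f.
Proof.
move=> zU Vp fUV feq rf; split=> // O zO OV; have [Op Os On] := zO.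
have [Up Us Un] := zU.
have rp (p : {mpoly K[dim Y]}) : lregular U (fun x => pev p (f x)).
  exact: lregular_meval.
have zP: zopen (fun x => U x /\ O (f x)).
  split=> [x [/Up]|x y [Ux Ox] py xy|x [Ux Ox]] //.
    have Uy: U y by apply: Us xy.
    by split=> //; apply: Os (feq _ _ Ux Uy xy) => //; apply/Vp/fUV.
  have [d dx dO] := On _ Ox; have [e ex eU] := Un x Ux.
  have [n [c [cx E]]] := rp d x Ux.
  have nx: pev n x != 0.
    by apply: contraNneq dx => nx; rewrite E // nx mul0r.
  exists (e * (c * n)); first by rewrite /pev !mevalM !mulf_neq0.
  move=> y py; rewrite /pev !mevalM !mulf_eq0 !negb_or => /and3P[ey cy ny].
  have Uy := eU y py ey; split=> //; apply: dO; first exact/Vp/fUV.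
  by rewrite E // mulf_neq0 // invr_neq0.
split=> // h [heq hr]; split=> [x y [Ux Ox] [Uy Oy] xy|x [Ux Ox]].
  by apply: heq => //; apply: feq.
have [n [d [dx E]]] := hr _ Ox.
have [nn [nd [ndx nE]]] := rp n x Ux; have [dn [dd [ddx dE]]] := rp d x Ux.
have dnx: pev dn x != 0.
  by apply: contraNneq dx => dnx; rewrite dE // dnx mul0r.
(* The composite is (nn / nd) / (dn / dd), where dd must not vanish either. *)
exists (nn * dd * dd), (nd * dn * dd); rewrite /pev !mevalM !mulf_neq0 //.
split=> // y [Uy Oy]; rewrite !mevalM !mulf_eq0 !negb_or -!/(pev _ _).
case/andP=> [/andP[ndy dny] ddy].
rewrite E ?nE ?dE // ?mulf_neq0 ?invr_neq0 //.
by rewrite invf_div mulf_div -[RHS]mulf_div divff ?mulr1.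
Qed.

End SpacesWithFunctions.

(** * The affine plane and plane curves *)

(** For the restriction of a polynomial to a parametrized curve: S is the ring of
    the polynomials in the parameters, and phi gives values to the parameters. *)
Lemma rmorph_mmap (R : comNzRingType) (S : comNzRingType) (c : {rmorphism R -> S})
    (phi : {rmorphism S -> R}) n (h : 'I_n -> S) (p : {mpoly R[n]}) :
  cancel c phi -> phi (mmap c h p) = p.@[fun i => phi (h i)].
Proof.
move=> cK; rewrite mevalE /mmap rmorph_sum; apply: eq_bigr => m _.
rewrite rmorphM /= cK /mmap1 rmorph_prod; congr (_ * _).
by apply: eq_bigr => i _; rewrite rmorphXn.
Qed.

Definition plane (K : fieldType) : qspace K :=
  @QSpace K 'rV[K]_2 2 id (fun=> True) eq.

Lemma plane_equivalence (K : fieldType) : RelationClasses.Equivalence (@eqv K (plane K)).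
Proof. by split=> [x|x y|x y z] //= -> . Qed.

(** Regularity of an expression whose atoms are regular by assumption. *)
Ltac lreg := repeat first
  [ assumption | exact: lregularC | apply: lregularN | apply: lregularD
  | apply: lregularX | apply: lregularM ].

Section PlaneCoordinates.
Variable K : fieldType.

Definition plane_pt (e : 'rV[K]_2) : K * K := (e 0 ord0, e 0 ord_max).
Definition plane_vec (P : K * K) : 'rV[K]_2 := \row_i (if i == ord0 then P.1 else P.2).

Lemma plane_vecK : cancel plane_vec plane_pt.
Proof. by case=> x y; rewrite /plane_pt /plane_vec !mxE. Qed.

Lemma plane_ptK : cancel plane_pt plane_vec.
Proof.
move=> e; apply/rowP => i; rewrite mxE; case: ifP => [/eqP->//|/negbT i0].
by congr (e 0 _); apply/val_inj; case: i i0 => [[|[|]]].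
Qed.

Lemma lregular_plane (U : car (plane K) -> Prop) :
  lregular U (fun e => (plane_pt e).1) /\ lregular U (fun e => (plane_pt e).2).
Proof. by split; apply: lregular_coord. Qed.

End PlaneCoordinates.

Section Density.
Variable K : closedFieldType.

(** The line through a point of one open set and a point of another meets both in
    cofinite sets. *)
Lemma plane_dense (U : car (plane K) -> Prop) v :
  zopen U -> U v -> dense_open U.
Proof.
move=> zU Uv; split=> // O zO [w Ow].
have [_ _ Un] := zU; have [_ _ On] := zO.
have [d dv dU] := Un v Uv; have [e ew eO] := On w Ow.
pose h i : {poly K} := (v 0 i)%:P + 'X * (w 0 i - v 0 i)%:P.
have hE i (l : K) : horner_eval l (h i) = (v + l *: (w - v)) 0 i.
  by rewrite /h /horner_eval !hornerE !mxE.
have polyCK (l : K) : cancel polyC (horner_eval l) by move=> c; exact: hornerC.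
have pE (p : {mpoly K[2]}) l :
    (mmap polyC h p).[l] = pev (X := plane K) p (v + l *: (w - v)).
  rewrite -/(horner_eval l _) rmorph_mmap; last exact: polyCK.
  by apply: meval_eq => i; exact: hE.
have: mmap polyC h d * mmap polyC h e != 0.
  rewrite mulf_neq0 //.
    by apply: contraNneq dv => d0; rewrite -[v]addr0 -(scale0r (w - v)) -pE d0 horner0.
  by apply: contraNneq ew => e0; rewrite -[w](addrNK v) addrC
    -[w - v]scale1r -pE e0 horner0.
case/closed_nonrootP => l; rewrite /root hornerM mulf_eq0 negb_or !pE => /andP[dl el].
by exists (v + l *: (w - v)); [apply: eO | apply: dU].
Qed.

(** The outer variable takes the value x, the inner one the value z. *)
Definition ev2 (x z : K) (P : {poly {poly K}}) : K := (map_poly (horner_eval z) P).[x].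

(** Every component of a plane curve [f(x,z) = 0], monic in [x], dominates the
    [z]-axis.  If [d] vanished on the curve away from finitely many values of
    [z], the remainder of a power of [d] by [f] would vanish for almost all [z],
    hence identically, and [f] would divide that power of [d]. *)
Lemma monic_curve_dense (f d : {poly {poly K}}) (e : {poly K}) x0 z0 :
    f \is monic -> ev2 x0 z0 f = 0 -> ev2 x0 z0 d != 0 -> e != 0 ->
  exists x z, [/\ e.[z] != 0, ev2 x z f = 0 & ev2 x z d != 0].
Proof.
move=> fm f0 d0 e0; set k := (size f).-1.
pose q := Pdiv.Ring.rdivp (d ^+ k) f; pose r := Pdiv.Ring.rmodp (d ^+ k) f.
have dE : d ^+ k = q * f + r by exact: Pdiv.RingMonic.rdivp_eq.
have rf : (size r < size f)%N.
  by rewrite Pdiv.Ring.ltn_rmodp monic_neq0.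
have [r0|r0] := eqVneq r 0.
  case/eqP: (expf_neq0 k d0); rewrite /ev2 -horner_exp -rmorphXn dE r0 addr0.
  by rewrite rmorphM hornerM [X in _ * X]f0 mulr0.
have /closed_nonrootP[z] : e * lead_coef r != 0.
  by rewrite mulf_neq0 // lead_coef_eq0.
rewrite /root hornerM mulf_eq0 negb_or => /andP[ez rz].
pose m := map_poly (horner_eval z).
have fzm : m f \is monic by exact: monic_map.
have sfz : size (m f) = size f.
  by rewrite size_map_poly_id0 // (monicP fm) rmorph1 oner_eq0.
have [a fzE] := closed_field_poly_normal (m f).
rewrite (monicP fzm) scale1r in fzE.
have sa : size a = k.
  by move: sfz; rewrite fzE size_prod_XsubC /k => <-.
case: (boolP (all (root (m d)) a)) => [/allP da|/allPn[x xa dx]]; last first.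
  exists x, z; split=> //; rewrite /ev2 -/m fzE; apply/eqP.
  by rewrite -/(root _ x) root_prod_XsubC.
have : m f %| m d ^+ k.
  rewrite fzE -sa; elim: a da {fzE sa} => [|x a IH] da.
    by rewrite big_nil dvd1p.
  rewrite big_cons exprS dvdp_mul //.
    by rewrite dvdp_XsubCl da ?mem_head.
  by apply: IH => y ya; rewrite da // inE ya orbT.
rewrite /m -rmorphXn dE rmorphD rmorphM /= dvdp_addr ?dvdp_mull // => /dvdp_leq.
rewrite -/m sfz.
have -> : m r != 0.
  by apply: contraNneq rz => mr; rewrite /lead_coef -[_.[z]](coef_map (horner_eval z)) -/m mr coef0.
move=> /(_ isT); rewrite leqNgt; case/negP.
by apply: leq_ltn_trans rf; exact: size_poly.
Qed.

End Density.

(** * Vectors and brackets *)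

Section Vectors.
Variable K : fieldType.
Implicit Types u v w : 'rV[K]_3.

Notation x0 v := (v 0 (inord 0)).
Notation x1 v := (v 0 (inord 1)).
Notation x2 v := (v 0 (inord 2)).

Lemma row3E (s : seq K) (k : nat) : (k < 3)%N ->
  (\row_(i < 3) s`_i) 0 (inord k) = s`_k.
Proof. by move=> k3; rewrite mxE inordK. Qed.

Lemma row3P u v : x0 u = x0 v -> x1 u = x1 v -> x2 u = x2 v -> u = v.
Proof.
move=> e0 e1 e2; apply/rowP => i; have -> : i = inord i by rewrite inord_val.
by case: i => [[|[|[|]]]].
Qed.

Lemma sum3E (F : 'I_3 -> K) : \sum_i F i = F (inord 0) + F (inord 1) + F (inord 2).
Proof.
rewrite !big_ord_recl big_ord0 addr0 addrA.
by congr (F _ + F _ + F _); apply/val_inj; rewrite /= inordK.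
Qed.

Lemma vec_ofK : cancel (@vec_of K) (@point_of K).
Proof.
by case=> [[x y]|]; rewrite /point_of /vec_of !row3E //= ?oner_eq0 ?eqxx // !divr1.
Qed.

Lemma crossE u v :
  [/\ x0 (cross u v) = x1 u * x2 v - x2 u * x1 v,
      x1 (cross u v) = x2 u * x0 v - x0 u * x2 v &
      x2 (cross u v) = x0 u * x1 v - x1 u * x0 v].
Proof. by rewrite /cross !row3E. Qed.

Lemma crossC u v : cross u v = - cross v u.
Proof.
have [e0 e1 e2] := crossE u v; have [f0 f1 f2] := crossE v u.
by apply: row3P; rewrite [RHS]mxE ?e0 ?e1 ?e2 ?f0 ?f1 ?f2; ring.
Qed.

Lemma crossNl u v : cross (- u) v = - cross u v.
Proof.
have [e0 e1 e2] := crossE (- u) v; have [f0 f1 f2] := crossE u v.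
by apply: row3P; rewrite [RHS]mxE ?e0 ?e1 ?e2 ?f0 ?f1 ?f2 !mxE; ring.
Qed.

Lemma vec_of_affE (P : K * K) : let v := vec_of (Some P) in
  [/\ x0 v = P.1, x1 v = P.2 & x2 v = 1].
Proof. by case: P => x y; rewrite /vec_of !row3E. Qed.

(** The determinant of the matrix with these rows. *)
Definition br u v w : K :=
  x0 u * (x1 v * x2 w - x2 v * x1 w) + x1 u * (x2 v * x0 w - x0 v * x2 w)
    + x2 u * (x0 v * x1 w - x1 v * x0 w).

Lemma br_rot u v w : br u v w = br v w u.
Proof. by rewrite /br; ring. Qed.

Lemma brC u v w : br u v w = - br v u w.
Proof. by rewrite /br; ring. Qed.

Lemma brZZZ a b c u v w : br (a *: u) (b *: v) (c *: w) = a * b * c * br u v w.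
Proof. by rewrite /br !mxE; ring. Qed.

Lemma br_same u v : br u u v = 0.
Proof. by rewrite /br; ring. Qed.

Lemma br_cross u v w : br u v w = \sum_(i < 3) cross u v 0 i * w 0 i.
Proof.
by have [e0 e1 e2] := crossE u v; rewrite sum3E e0 e1 e2 /br; ring.
Qed.

(** The determinant of a 3 x 3 matrix. *)
Definition mxbr (g : 'M[K]_3) : K := br (row (inord 0) g) (row (inord 1) g) (row (inord 2) g).

Lemma mulmx3E u (g : 'M[K]_3) i :
  (u *m g) 0 i = x0 u * g (inord 0) i + x1 u * g (inord 1) i + x2 u * g (inord 2) i.
Proof. by rewrite mxE sum3E. Qed.

Lemma br_mulmx u v w g : br (u *m g) (v *m g) (w *m g) = br u v w * mxbr g.
Proof. by rewrite /mxbr /br !mulmx3E !mxE; ring. Qed.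

Lemma mxbr_unit g : g \in unitmx -> mxbr g != 0.
Proof.
move=> ug; have : mxbr (invmx g) * mxbr g = mxbr 1%:M.
  by rewrite {1}/mxbr -br_mulmx -!row_mul mulVmx.
move=> E; apply: contra_eq_neq E => ->; rewrite mulr0 eq_sym /mxbr /br.
have e i j : (i < 3)%N -> (j < 3)%N ->
    (row (inord i) 1%:M : 'rV[K]_3) 0 (inord j) = (i == j)%:R.
  by move=> i3 j3; rewrite !mxE -val_eqE /= !inordK.
by rewrite !e //= !(mulr0, mul0r, mulr1, subr0, addr0) oner_eq0.
Qed.

Lemma cross_cross a b c d :
  cross (cross a b) (cross c d) = br a b d *: c - br a b c *: d.
Proof.
have [e0 e1 e2] := crossE a b; have [f0 f1 f2] := crossE c d.
have [g0 g1 g2] := crossE (cross a b) (cross c d).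
by apply: row3P; rewrite ?g0 ?g1 ?g2 ?e0 ?e1 ?e2 ?f0 ?f1 ?f2 !mxE /br; ring.
Qed.

Lemma br_meet1 a b c d : br a b (cross (cross a b) (cross c d)) = 0.
Proof.
rewrite br_cross sum3E /=; have [-> -> ->] := crossE (cross a b) (cross c d); ring.
Qed.

Lemma br_meet2 a b c d : br c d (cross (cross a b) (cross c d)) = 0.
Proof.
rewrite br_cross sum3E /=; have [-> -> ->] := crossE (cross a b) (cross c d); ring.
Qed.

Lemma crossZ k l u v : cross (k *: u) (l *: v) = (k * l) *: cross u v.
Proof.
have [e0 e1 e2] := crossE (k *: u) (l *: v); have [f0 f1 f2] := crossE u v.
by apply: row3P; rewrite [RHS]mxE ?e0 ?e1 ?e2 ?f0 ?f1 ?f2 !mxE; ring.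
Qed.

(** The meet of two lines is a combination of points with brackets as coefficients,
    and all brackets are multiplied by the same determinant. *)
Lemma cross_cross_mulmx a b c d g :
  cross (cross (a *m g) (b *m g)) (cross (c *m g) (d *m g)) =
  mxbr g *: (cross (cross a b) (cross c d) *m g).
Proof.
rewrite !cross_cross !br_mulmx mulmxBl -!scalemxAl scalerBr !scalerA.
by rewrite ![_ * mxbr g]mulrC.
Qed.

(** The vector cross l m represents the only candidate for the common point. *)
Lemma concurrent_br l m n : cross l m != 0 -> concurrent l m n <-> br l m n = 0.
Proof.
move=> lm0; split=> [[p p0 [pl pm pn]]|E].
  have pE (u : 'rV[K]_3) : on_line p u -> x0 p * x0 u + x1 p * x1 u + x2 p * x2 u = 0.
    by rewrite /on_line sum3E.
  move: pl pm pn => /pE pl /pE pm /pE pn.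
  have k0 : x0 p * br l m n = 0.
    transitivity ((x0 p * x0 n + x1 p * x1 n + x2 p * x2 n) * (x1 l * x2 m - x2 l * x1 m)
      + (x0 p * x0 l + x1 p * x1 l + x2 p * x2 l) * (x1 m * x2 n - x2 m * x1 n)
      + (x0 p * x0 m + x1 p * x1 m + x2 p * x2 m) * (x1 n * x2 l - x2 n * x1 l)).
      by rewrite /br; ring.
    by rewrite pl pm pn !mul0r !addr0.
  have k1 : x1 p * br l m n = 0.
    transitivity ((x0 p * x0 n + x1 p * x1 n + x2 p * x2 n) * (x2 l * x0 m - x0 l * x2 m)
      + (x0 p * x0 l + x1 p * x1 l + x2 p * x2 l) * (x2 m * x0 n - x0 m * x2 n)
      + (x0 p * x0 m + x1 p * x1 m + x2 p * x2 m) * (x2 n * x0 l - x0 n * x2 l)).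
      by rewrite /br; ring.
    by rewrite pl pm pn !mul0r !addr0.
  have k2 : x2 p * br l m n = 0.
    transitivity ((x0 p * x0 n + x1 p * x1 n + x2 p * x2 n) * (x0 l * x1 m - x1 l * x0 m)
      + (x0 p * x0 l + x1 p * x1 l + x2 p * x2 l) * (x0 m * x1 n - x1 m * x0 n)
      + (x0 p * x0 m + x1 p * x1 m + x2 p * x2 m) * (x0 n * x1 l - x1 n * x0 l)).
      by rewrite /br; ring.
    by rewrite pl pm pn !mul0r !addr0.
  apply: contraNeq p0 => E; apply/eqP/row3P; rewrite [RHS]mxE;
    by apply: (mulIf E); rewrite ?k0 ?k1 ?k2 mul0r.
exists (cross l m) => //; split; rewrite /on_line -br_cross //.
  by rewrite br_rot br_rot br_same.
by rewrite br_rot br_same.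
Qed.

Lemma cross_same u : cross u u = 0.
Proof. by have [e0 e1 e2] := crossE u u; apply: row3P; rewrite [RHS]mxE ?e0 ?e1 ?e2; ring. Qed.

Lemma cross0 u : cross 0 u = 0.
Proof.
by have [e0 e1 e2] := crossE 0 u; apply: row3P; rewrite [RHS]mxE ?e0 ?e1 ?e2 !mxE; ring.
Qed.

Lemma cross_crossr w a b :
  cross w (cross a b) = (\sum_(i < 3) b 0 i * w 0 i) *: a - (\sum_(i < 3) a 0 i * w 0 i) *: b.
Proof.
have [c0 c1 c2] := crossE w (cross a b); have [d0 d1 d2] := crossE a b.
by rewrite !sum3E /=; apply: row3P; rewrite ?c0 ?c1 ?c2 ?d0 ?d1 ?d2 !mxE; ring.
Qed.

Lemma arr_equiv_equivalence (T : Type) :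
  RelationClasses.Equivalence (@arr_equiv K T).
Proof.
split=> [A|A B [g ug AB]|A B C [g ug AB] [h uh BC]].
- exists 1%:M => [|i]; first exact: unitmx1.
  by exists 1; rewrite ?oner_eq0 // mulmx1 scale1r.
- exists (invmx g) => [|i]; first by rewrite unitmx_inv.
  have [c c0 ->] := AB i; exists c^-1; rewrite ?invr_neq0 //.
  by rewrite -scalemxAl mulmxK // scalerA mulVf ?scale1r.
- exists (g *m h) => [|i]; first by rewrite unitmx_mul ug.
  have [c c0 Bi] := AB i; have [d d0 ->] := BC i; exists (d * c); rewrite ?mulf_neq0 //.
  by rewrite Bi -scalemxAl scalerA mulmxA.
Qed.

Lemma Psi_equiv (A B : pentagon K) : arr_equiv A B -> arr_equiv (Psi A) (Psi B).
Proof.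
case=> g ug AB; exists g => // j.
have cc (a b c d : 'Z_5) : exists2 k : K, k != 0 &
    cross (cross (B a) (B b)) (cross (B c) (B d)) =
    k *: (cross (cross (A a) (A b)) (cross (A c) (A d)) *m g).
  have [ka ka0 ->] := AB a; have [kb kb0 ->] := AB b.
  have [kc kc0 ->] := AB c; have [kd kd0 ->] := AB d.
  exists (ka * kb * (kc * kd) * mxbr g); first by rewrite !mulf_neq0 ?mxbr_unit.
  by rewrite !crossZ cross_cross_mulmx scalerA.
by case: j => [[|[|[|[|[|]]]]] j5] //; apply: cc.
Qed.

End Vectors.

(** * Changes of Weierstrass coordinates *)

Section Change.
Variable K : fieldType.
Implicit Types (E : wcurve K) (P Q : wpoint K).

Definition wcurve_change (u r s w : K) E : wcurve K :=
  WCurve ((a1 E + 2 * s) / u)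
         ((a2 E - s * a1 E + 3 * r - s ^+ 2) / u ^+ 2)
         ((a3 E + r * a1 E + 2 * w) / u ^+ 3)
         ((a4 E - s * a3 E + 2 * r * a2 E - (w + r * s) * a1 E + 3 * r ^+ 2 - 2 * s * w) / u ^+ 4)
         ((a6 E + r * a4 E + r ^+ 2 * a2 E + r ^+ 3 - w * a3 E - w ^+ 2 - r * w * a1 E) / u ^+ 6).

Lemma weq_change u r s w E x y : u != 0 ->
  weq E (u ^+ 2 * x + r) (u ^+ 3 * y + s * u ^+ 2 * x + w) 1 =
    u ^+ 6 * weq (wcurve_change u r s w E) x y 1.
Proof. by move=> u0; rewrite /weq /=; field. Qed.

(** The values at (0, 0), (0, 1), (1, 0), (-1, 0) and (1, 1) determine all the
    coefficients. *)
Lemma weq_inj E E' : 2 != 0 :> K ->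
  (forall x y, weq E x y 1 = weq E' x y 1) -> E = E'.
Proof.
move=> two0; case: E E' => [b1 b2 b3 b4 b6] [c1 c2 c3 c4 c6] /= H.
have F x y : (b1 - c1) * (x * y) + (b3 - c3) * y - (b2 - c2) * x ^+ 2
             - (b4 - c4) * x - (b6 - c6) = 0.
  by apply/eqP; rewrite -(subrr (weq (WCurve b1 b2 b3 b4 b6) x y 1)) {2}H /weq /=;
     apply/eqP; ring.
have e6 : b6 - c6 = 0 by apply: oppr_inj; rewrite oppr0 -[RHS](F 0 0); ring.
have e3 : b3 - c3 = 0 by rewrite -[RHS](F 0 1) e6; ring.
have e4 : b4 - c4 = 0.
  apply: (mulfI two0); rewrite mulr0.
  by have := congr2 (fun p q => p - q) (F (-1) 0) (F 1 0); rewrite subrr => <-; ring.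
have e2 : b2 - c2 = 0.
  by apply: oppr_inj; rewrite oppr0 -[RHS](F 1 0) e4 e6; ring.
have e1 : b1 - c1 = 0 by rewrite -[RHS](F 1 1) e2 e3 e4 e6; ring.
by congr WCurve; apply/eqP; rewrite -subr_eq0; apply/eqP.
Qed.

Lemma weq_change_uniq u r s w E E' : 2 != 0 :> K -> u != 0 ->
    (forall x y, weq E (u ^+ 2 * x + r) (u ^+ 3 * y + s * u ^+ 2 * x + w) 1 =
                 u ^+ 6 * weq E' x y 1) ->
  E' = wcurve_change u r s w E.
Proof.
move=> two0 u0 H; apply: weq_inj => // x y.
by apply: (mulfI (expf_neq0 6 u0)); rewrite -H weq_change.
Qed.

Lemma wdisc_change u r s w E : u != 0 ->
  wdisc E = u ^+ 12 * wdisc (wcurve_change u r s w E).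
Proof. by move=> u0; rewrite /wdisc /=; field. Qed.

Definition on_wcurve E P : Prop := if P is Some (x, y) then weq E x y 1 = 0 else True.

Lemma on_wcurveE E x y : on_wcurve E (Some (x, y)) ->
  y ^+ 2 = x ^+ 3 + a2 E * x ^+ 2 + a4 E * x + a6 E - a1 E * x * y - a3 E * y.
Proof. by rewrite /on_wcurve /weq => h; apply/eqP; rewrite -subr_eq0 -h; apply/eqP; ring. Qed.

(** Two points of the curve with the same abscissa are equal or opposite. *)
Lemma wadd_same_x E x y1 y2 :
    on_wcurve E (Some (x, y1)) -> on_wcurve E (Some (x, y2)) ->
  y1 + y2 + a1 E * x + a3 E != 0 -> y1 = y2.
Proof.
move=> /on_wcurveE h1 /on_wcurveE h2 n0; apply/eqP; rewrite -subr_eq0.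
suff /eqP: (y1 - y2) * (y1 + y2 + a1 E * x + a3 E) = 0.
  by rewrite mulf_eq0 (negPf n0) orbF.
by ring: h1 h2.
Qed.

Lemma wadd_on_wcurve E P Q :
  on_wcurve E P -> on_wcurve E Q -> on_wcurve E (wadd E P Q).
Proof.
case: P Q => [[x1 y1]|] [[x2 y2]|] // oP oQ.
rewrite /wadd; case: ifPn => // N.
have [xx|xx] := eqVneq x1 x2.
  rewrite xx eqxx /= in N oP *; have yy := wadd_same_x oP oQ N; rewrite yy in oP N *.
  have D : 2 * y2 + a1 E * x2 + a3 E != 0.
    by apply: contraNneq N => h; rewrite -h; apply/eqP; ring.
  by move/on_wcurveE: oP => h; rewrite /on_wcurve /weq; field: h; exact: D.
have D : x2 - x1 != 0 by rewrite subr_eq0 eq_sym.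
move/on_wcurveE: oP => h; move/on_wcurveE: oQ => h'.
by rewrite /on_wcurve /weq; field: h h'; exact: D.
Qed.

Lemma wmul_on_wcurve E m P : on_wcurve E P -> on_wcurve E (wmul E m P).
Proof. by move=> oP; elim: m => // m IH; apply: wadd_on_wcurve. Qed.

Section Equivariance.
Variables (u r s w : K) (E : wcurve K).
Hypothesis u0 : u != 0.
Let E' := wcurve_change u r s w E.
Let phi := wchange u r s w.

Lemma wneg_change P : wneg E (phi P) = phi (wneg E' P).
Proof.
by case: P => [[x y]|] //=; congr (Some (_, _)); rewrite /=; field.
Qed.

Lemma on_wcurve_change P : on_wcurve E (phi P) <-> on_wcurve E' P.
Proof.
case: P => [[x y]|] //; rewrite /on_wcurve /= weq_change //.
split=> [/eqP|->]; last by rewrite mulr0.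
by rewrite mulf_eq0 expf_eq0 (negPf u0) /= => /eqP.
Qed.

(** Changes of coordinates preserve lines and vertical lines. On arbitrary points
    with the same abscissa but different ordinates the tangent formula would not
    be equivariant, hence the restriction to the curve. *)
Lemma wadd_change P Q : on_wcurve E' P -> on_wcurve E' Q ->
  wadd E (phi P) (phi Q) = phi (wadd E' P Q).
Proof.
case: P Q => [[x1 y1]|] [[x2 y2]|] // oP oQ.
have u2 := expf_neq0 2 u0; have u3 := expf_neq0 3 u0.
have ex : (u ^+ 2 * x1 + r == u ^+ 2 * x2 + r) = (x1 == x2).
  by rewrite (inj_eq (addIr r)) (inj_eq (mulfI u2)).
have [xx|xx] := eqVneq x1 x2; last first.
  rewrite /= ex (negPf xx) /=; rewrite eq_sym -subr_eq0 in xx.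
  have D : u ^+ 2 * x2 + r - (u ^+ 2 * x1 + r) != 0.
    by rewrite (_ : _ - _ = u ^+ 2 * (x2 - x1)) ?mulf_neq0 //; ring.
  by congr (Some (_, _)) => /=; field; rewrite u0 xx D.
rewrite /= ex xx eqxx /=; rewrite xx in oP.
have -> : u ^+ 3 * y1 + s * u ^+ 2 * x2 + w + (u ^+ 3 * y2 + s * u ^+ 2 * x2 + w)
     + a1 E * (u ^+ 2 * x2 + r) + a3 E =
   u ^+ 3 * (y1 + y2 + (a1 E + 2 * s) / u * x2 + (a3 E + r * a1 E + 2 * w) / u ^+ 3).
  by field.
rewrite mulf_eq0 (negPf u3) /=; case: ifPn => // N.
have yy := wadd_same_x oP oQ N; rewrite yy in N *.
have D' : 2 * y2 + (a1 E + 2 * s) / u * x2 + (a3 E + r * a1 E + 2 * w) / u ^+ 3 != 0.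
  by apply: contraNneq N => h; rewrite -h; apply/eqP; ring.
have D : 2 * (u ^+ 3 * y2 + s * u ^+ 2 * x2 + w) + a1 E * (u ^+ 2 * x2 + r) + a3 E != 0.
  rewrite (_ : _ + a3 E = u ^+ 3 * (2 * y2 + (a1 E + 2 * s) / u * x2
    + (a3 E + r * a1 E + 2 * w) / u ^+ 3)); last by field.
  by rewrite mulf_neq0.
by congr (Some (_, _)); field; rewrite u0;
  apply: contraNneq D => h; rewrite -h; apply/eqP; ring.
Qed.

Lemma wmul_change m P : on_wcurve E' P -> wmul E m (phi P) = phi (wmul E' m P).
Proof.
move=> oP; elim: m => // m IH.
by rewrite /wmul !iterS -!/(wmul _ _ _) IH wadd_change //; apply: wmul_on_wcurve.
Qed.

End Equivariance.

(** A change of Weierstrass coordinates is a projective transformation. *)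
Definition change_mx (u r s w : K) : 'M[K]_3 :=
  \matrix_(i, j) nth 0 (nth [::] [:: [:: u ^+ 2; s * u ^+ 2; 0]; [:: 0; u ^+ 3; 0];
                                    [:: r; w; 1]] i) j.

Lemma change_mx_unit u r s w : u != 0 -> change_mx u r s w \in unitmx.
Proof.
move=> u0.
have /mulmx1_unit[] // : change_mx u r s w *m
    change_mx u^-1 (- r / u ^+ 2) (- s / u) ((s * r - w) / u ^+ 3) = 1%:M.
apply/matrixP => i j; rewrite mxE sum3E !mxE !inordK //.
by case: i => [[|[|[|//]]] ?]; case: j => [[|[|[|//]]] ?]; rewrite -val_eqE /=; field.
Qed.

Lemma vec_of_change u r s w P : u != 0 -> exists2 c : K, c != 0 &
  vec_of (wchange u r s w P) = c *: (vec_of P *m change_mx u r s w).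
Proof.
have e i j : (i < 3)%N -> (j < 3)%N -> change_mx u r s w (inord i) (inord j) =
    nth 0 (nth [::] [:: [:: u ^+ 2; s * u ^+ 2; 0]; [:: 0; u ^+ 3; 0]; [:: r; w; 1]] i) j.
  by move=> i3 j3; rewrite mxE !inordK.
move=> u0; case: P => [[x y]|].
  exists 1; rewrite ?oner_eq0 // scale1r.
  by apply: row3P; rewrite mulmx3E !e // /vec_of !row3E //=; ring.
exists (u ^+ 3)^-1; first by rewrite invr_neq0 ?expf_neq0.
by apply: row3P; rewrite [RHS]mxE mulmx3E !e // /vec_of !row3E //=; field.
Qed.

Lemma triple_iso_equivalence : RelationClasses.Equivalence (@triple_iso K).
Proof.
split=> [T|T T' [u [r [s [w [u0 H Hp Ht]]]]]|
         T1 T2 T3 [u [r [s [w [u0 H Hp Ht]]]]] [u' [r' [s' [w' [u'0 H' Hp' Ht']]]]]].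
- exists 1, 0, 0, 0; split=> [|x y||]; first exact: oner_neq0.
  + by rewrite /weq; ring.
  + by case: (point_of _) => [[x y]|] //=; congr (Some (_, _)); ring.
  + by case: (point_of _) => [[x y]|] //=; congr (Some (_, _)); ring.
- have inv P Q : P = wchange u r s w Q ->
      Q = wchange u^-1 (- r / u ^+ 2) (- s / u) ((s * r - w) / u ^+ 3) P.
    by move=> ->; case: Q => [[x y]|] //=; congr (Some (_, _)); field.
  exists u^-1, (- r / u ^+ 2), (- s / u), ((s * r - w) / u ^+ 3).
  split=> [|x y||]; [by rewrite invr_neq0 | | exact: inv | exact: inv].
  apply: (mulfI (expf_neq0 6 u0)); rewrite -H [RHS]mulrA -exprMn mulfV // expr1n mul1r.
  by congr (weq _ _ _ _); field.
- have comp P : wchange u r s w (wchange u' r' s' w' P) =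
      wchange (u * u') (u ^+ 2 * r' + r) (s + u * s')
        (u ^+ 3 * w' + s * u ^+ 2 * r' + w) P.
    by case: P => [[x y]|] //=; congr (Some (_, _)); ring.
  exists (u * u'), (u ^+ 2 * r' + r), (s + u * s'), (u ^+ 3 * w' + s * u ^+ 2 * r' + w).
  split=> [|x y||]; [by rewrite mulf_neq0 | | by rewrite Hp Hp' comp | by rewrite Ht Ht' comp].
  rewrite [(u * u') ^+ 6]exprMn -[RHS]mulrA -H' -H; congr (weq _ _ _ _); ring.
Qed.

Lemma triple_iso_change (T T' : triple K) : 2 != 0 :> K -> triple_iso T T' <->
  exists u r s w : K, [/\ u != 0, tcurve T' = wcurve_change u r s w (tcurve T),
    point_of (tpoint T) = wchange u r s w (point_of (tpoint T')) &
    point_of (ttors T) = wchange u r s w (point_of (ttors T'))].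
Proof.
move=> two0; split=> [] [u [r [s [w [u0 H Hp Ht]]]]]; exists u, r, s, w; split=> //.
  exact: weq_change_uniq.
by move=> x y; rewrite H weq_change.
Qed.

Lemma on_curve_point_of E v : on_curve E v -> on_wcurve E (point_of v).
Proof.
case=> v0; rewrite /point_of; set x := v 0 _; set y := v 0 _; set z := v 0 _ => H.
have [//|z0] := eqVneq z 0; rewrite /on_wcurve -[RHS](mul0r (z ^+ 3)^-1) -H /weq.
by field.
Qed.

Lemma on_curve_vec_of E P : on_wcurve E P -> on_curve E (vec_of P).
Proof.
move=> oP; split.
  apply: contraTneq isT => E0; case: P E0 {oP} => [[x y]|] E0.
    have := congr1 (fun v : 'rV[K]_3 => v 0 (inord 2)) E0.
    by rewrite /vec_of row3E // mxE => /eqP; rewrite oner_eq0.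
  have := congr1 (fun v : 'rV[K]_3 => v 0 (inord 1)) E0.
  by rewrite /vec_of row3E // mxE => /eqP; rewrite oner_eq0.
case: P oP => [[x y]|]; rewrite /vec_of !row3E //= => _.
by rewrite /weq; ring.
Qed.

End Change.

(** * Translation and duplication on a Tate curve *)

Section TateCurve.
Variables (K : fieldType) (b : K).
Hypothesis b0 : b != 0.

(** Tate's normal form: the curve through t = (0, 0) with tangent y = 0 on which t
    has order 5, its multiples being (b, b ^+ 2), (b, 0) and (0, b). *)
Definition tcrv : wcurve K := WCurve (1 - b) (- b) (- b) 0 0.

(** Translation by t, simplified by means of the equation of the curve. *)
Definition tau (P : K * K) : K * K :=
  (b * P.2 / P.1 ^+ 2, b ^+ 2 * (P.1 ^+ 2 - P.2) / P.1 ^+ 3).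

Definition on_tate (P : K * K) : Prop :=
  P.2 ^+ 2 = P.1 ^+ 3 - b * P.1 ^+ 2 - (1 - b) * P.1 * P.2 + b * P.2.

(** On the curve, the abscissas 0 and b are those of t, 2t, 3t and 4t. *)
Definition off_torsion (P : K * K) : Prop :=
  [/\ on_tate P, P.1 != 0 & P.1 != b].

(** On the curve, the ordinate y vanishes only at t and 3t, and x ^+ 2 - y only at
    t and 2t. *)
Lemma off_torsion_neq P : off_torsion P -> P.2 != 0 /\ P.1 ^+ 2 != P.2.
Proof.
case: P => x y [/= E x0 xb]; rewrite /on_tate /= in E; have xb' : x - b != 0 by rewrite subr_eq0.
split; apply/eqP=> H.
  suff /eqP: x ^+ 2 * (x - b) = 0 by rewrite !mulf_eq0 (negPf x0) (negPf xb').
  rewrite -[RHS](subrr (y ^+ 2)) {1}E H; ring.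
suff /eqP: x ^+ 3 * (x - b) = 0 by rewrite !mulf_eq0 (negPf x0) (negPf xb').
by move: E; rewrite /on_tate /= -H => E; ring: E.
Qed.

Lemma off_torsion_tau P : off_torsion P -> off_torsion (tau P).
Proof.
move=> NP; have [y0 xy] := off_torsion_neq NP; move: NP y0 xy.
case: P => x y [/= E x0 xb] y0 xy; rewrite /on_tate /= in E.
have xy' : x ^+ 2 - y != 0 by rewrite subr_eq0.
split=> /=; first 1 last.
- by rewrite !mulf_neq0 ?invr_neq0 ?expf_neq0.
- rewrite -subr_eq0.
  have -> : b * y / x ^+ 2 - b = - (b * (x ^+ 2 - y)) / x ^+ 2 by field.
  by rewrite !mulf_neq0 ?oppr_eq0 ?mulf_neq0 ?invr_neq0 ?expf_neq0.
rewrite /on_tate /=; field: E; exact: x0.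
Qed.

(** Up to a power of the abscissa, this is the value at P + t of the second function
    of [off_torsion_neq]. *)
Lemma off_torsion_tau_neq P : off_torsion P ->
  (b * P.2) ^+ 2 + - (b ^+ 2 * (P.1 ^+ 2 - P.2)) * P.1 != 0.
Proof.
move=> NP; have [_ ] := off_torsion_neq (off_torsion_tau NP).
case: NP => _ x0 _; apply: contraNneq => h.
rewrite -subr_eq0; apply/eqP.
transitivity (((b * P.2) ^+ 2 + - (b ^+ 2 * (P.1 ^+ 2 - P.2)) * P.1) / P.1 ^+ 4).
  by rewrite /=; field; rewrite x0.
by rewrite h mul0r.
Qed.

Lemma wadd_neq (E : wcurve K) (P Q : K * K) : P.1 != Q.1 ->
  wadd E (Some P) (Some Q) =
    let s := (Q.2 - P.2) / (Q.1 - P.1) in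
    let x := s ^+ 2 + a1 E * s - a2 E - P.1 - Q.1 in
    Some (x, - (s * (x - P.1) + P.2) - a1 E * x - a3 E).
Proof. by case: P Q => [x1 y1] [x2 y2] /= /negPf->. Qed.

Lemma wadd_t P : off_torsion P ->
  wadd tcrv (Some P) (Some (0, 0)) = Some (tau P).
Proof.
case=> E x0 xb; rewrite wadd_neq //=; move: E x0 xb.
case: P => x y; rewrite /on_tate /= => E x0 xb.
by congr (Some (_, _)) => /=; field: E; rewrite ?oppr_eq0 ?x0.
Qed.

Lemma wadd_2t P : off_torsion P ->
  wadd tcrv (Some P) (Some (b, b ^+ 2)) = Some (tau (tau P)).
Proof.
move=> NP; have [y0 xy] := off_torsion_neq NP; have := off_torsion_tau_neq NP; move: NP y0 xy.
case=> E x0 xb y0 xy z0; rewrite wadd_neq //=; move: E x0 xb y0 xy z0.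
case: P => x y; rewrite /on_tate /= => E x0 xb y0 xy z0.
have bx : b - x != 0 by rewrite subr_eq0 eq_sym.
by congr (Some (_, _)) => /=; field: E; rewrite x0 y0 b0.
Qed.

Lemma wadd_3t P : off_torsion P ->
  wadd tcrv (Some P) (Some (b, 0)) = Some (tau (tau (tau P))).
Proof.
move=> NP; have [y0 xy] := off_torsion_neq NP; have := off_torsion_tau_neq NP; move: NP y0 xy.
case=> E x0 xb y0 xy z0; rewrite wadd_neq //=; move: E x0 xb y0 xy z0.
case: P => x y; rewrite /on_tate /= => E x0 xb y0 xy z0.
have bx : b - x != 0 by rewrite subr_eq0 eq_sym.
have xy' : x ^+ 2 - y != 0 by rewrite subr_eq0.
congr (Some (_, _)) => /=; (field: E); by rewrite ?z0 ?x0 ?y0 ?b0 ?xy' ?oppr_eq0 ?bx ?x0.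
Qed.

Lemma wadd_4t P : off_torsion P ->
  wadd tcrv (Some P) (Some (0, b)) = Some (tau (tau (tau (tau P)))).
Proof.
move=> NP; have [y0 xy] := off_torsion_neq NP; have := off_torsion_tau_neq NP; move: NP y0 xy.
case=> E x0 xb y0 xy z0; rewrite wadd_neq //=; move: E x0 xb y0 xy z0.
case: P => x y; rewrite /on_tate /= => E x0 xb y0 xy z0.
have bx : b - x != 0 by rewrite subr_eq0 eq_sym.
have xy' : x ^+ 2 - y != 0 by rewrite subr_eq0.
congr (Some (_, _)) => /=; (field: E); by rewrite ?z0 ?x0 ?y0 ?b0 ?xy' ?oppr_eq0 ?bx ?x0.
Qed.

(** This vanishes when the tangent at P is vertical. *)
Definition dbl_den (P : K * K) : K := 2 * P.2 + (1 - b) * P.1 - b.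

(** The third intersection of the tangent at P with the curve, which is -2P. *)
Definition neg_dbl (P : K * K) : K * K :=
  let l := (3 * P.1 ^+ 2 - 2 * b * P.1 - (1 - b) * P.2) / dbl_den P in
  let x := l ^+ 2 + (1 - b) * l + b - 2 * P.1 in
  (x, l * (x - P.1) + P.2).

(** The determinant of the points (x : y : 1), which vanishes on collinear triples. *)
Definition det3 (P Q R : K * K) : K :=
  P.1 * (Q.2 - R.2) - P.2 * (Q.1 - R.1) + (Q.1 * R.2 - Q.2 * R.1).

(** Translation by 4t = -t. *)
Definition tauI (P : K * K) : K * K :=
  (b * (b - P.1) / P.2, b * P.1 * (P.1 - b) ^+ 2 / P.2 ^+ 2).

Lemma tau4 P : off_torsion P -> tau (tau (tau (tau P))) = tauI P.
Proof.
move=> NP; have [y0 xy] := off_torsion_neq NP; have := off_torsion_tau_neq NP; move: NP y0 xy.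
case=> E x0 xb y0 xy z0.
case: P E x0 xb y0 xy z0=> x y; rewrite /on_tate /tau /tauI /= => E x0 xb y0 xy z0.
have xy' : x ^+ 2 - y != 0 by rewrite subr_eq0.
by congr (_, _) => /=; (field: E); rewrite x0 y0 b0 xy' z0.
Qed.

Lemma tauK P : off_torsion P -> tau (tauI P) = P.
Proof.
move=> NP; have [y0 xy] := off_torsion_neq NP; move: NP y0 xy.
case=> E x0 xb y0 xy.
case: P E x0 xb y0 xy => x y; rewrite /on_tate /tau /tauI /= => E x0 xb y0 xy.
have bx : b - x != 0 by rewrite subr_eq0 eq_sym.
by congr (_, _) => /=; (field: E); rewrite y0 b0 bx.
Qed.

Lemma tau5 P : off_torsion P -> tau (tau (tau (tau (tau P)))) = P.
Proof. by move=> NP; rewrite (tau4 NP) tauK. Qed.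

Lemma neg_dbl_on_tate P : off_torsion P -> dbl_den P != 0 -> on_tate (neg_dbl P).
Proof.
move=> NP; have [y0 xy] := off_torsion_neq NP; have := off_torsion_tau_neq NP; move: NP y0 xy.
case=> E x0 xb y0 xy z0.
case: P E x0 xb y0 xy z0 => x y; rewrite /on_tate /det3 /neg_dbl /dbl_den /tau /= => E x0 xb y0 xy z0 D0.
have xy' : x ^+ 2 - y != 0 by rewrite subr_eq0.
by field: E; exact: D0.
Qed.

(** The points P + t, P - t and -2P add up to 0. *)
Lemma neg_dbl_collinear1 P : off_torsion P -> dbl_den P != 0 ->
  det3 (tau P) (tau (tau (tau (tau P)))) (neg_dbl P) = 0.
Proof.
move=> NP; have [y0 xy] := off_torsion_neq NP; have := off_torsion_tau_neq NP; move: NP y0 xy.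
case=> E x0 xb y0 xy z0.
case: P E x0 xb y0 xy z0 => x y; rewrite /on_tate /det3 /neg_dbl /dbl_den /tau /= => E x0 xb y0 xy z0 D0.
have xy' : x ^+ 2 - y != 0 by rewrite subr_eq0.
by field: E; rewrite D0 x0 y0 b0 xy' z0.
Qed.

(** The points P + 2t, P + 3t and -2P add up to 0. *)
Lemma neg_dbl_collinear2 P : off_torsion P -> dbl_den P != 0 ->
  det3 (tau (tau P)) (tau (tau (tau P))) (neg_dbl P) = 0.
Proof.
move=> NP; have [y0 xy] := off_torsion_neq NP; have := off_torsion_tau_neq NP; move: NP y0 xy.
case=> E x0 xb y0 xy z0.
case: P E x0 xb y0 xy z0 => x y; rewrite /on_tate /det3 /neg_dbl /dbl_den /tau /= => E x0 xb y0 xy z0 D0.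
have xy' : x ^+ 2 - y != 0 by rewrite subr_eq0.
by field: E; rewrite D0 x0 y0 b0 xy'.
Qed.

(** This is -2P + 3t = -2(P + t). *)
Lemma wadd_neg_dbl P :
    off_torsion P -> dbl_den P != 0 -> dbl_den (tau P) != 0 ->
    (neg_dbl P).1 != b ->
  wadd tcrv (Some (neg_dbl P)) (Some (b, 0)) = Some (neg_dbl (tau P)).
Proof.
move=> NP D0 D1 R0; rewrite wadd_neq //; move: D0 D1 R0.
case: NP => E x0 xb.
case: P E x0 xb => x y; rewrite /on_tate /neg_dbl /dbl_den /tau /= => E x0 xb D0 D1 R0.
(* The side conditions are the numerators of the hypotheses D1 and R0. *)
congr (Some (_, _)); (field: E); (apply/and4P; split=> //).
- apply: contraNneq D1 => h; apply/eqP.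
  by rewrite -[RHS](mul0r (x ^+ 3)^-1) -h; field.
- apply: contraNneq R0 => h; rewrite -subr_eq0; apply/eqP.
  by rewrite -[RHS](mul0r (- (2 * y + (1 - b) * x - b) ^+ 2)^-1) -h; field; rewrite oppr_eq0 expf_neq0.
- apply: contraNneq D1 => h; apply/eqP.
  by rewrite -[RHS](mul0r (x ^+ 3)^-1) -h; field.
- apply: contraNneq R0 => h; rewrite -subr_eq0; apply/eqP.
  by rewrite -[RHS](mul0r (- (2 * y + (1 - b) * x - b) ^+ 2)^-1) -h; field; rewrite oppr_eq0 expf_neq0.
Qed.

Lemma neg_dbl_tau P :
    off_torsion P -> dbl_den P != 0 -> dbl_den (tau P) != 0 ->
    off_torsion (neg_dbl P) ->
  neg_dbl (tau P) = tau (tau (tau (neg_dbl P))).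
Proof.
move=> NP D0 D1 NR; apply: Some_inj; rewrite -wadd_3t ?wadd_neg_dbl //.
by case: NR.
Qed.

Lemma wadd_dbl P : dbl_den P != 0 ->
  wneg tcrv (wadd tcrv (Some P) (Some P)) = Some (neg_dbl P).
Proof.
case: P => x y; rewrite /dbl_den /= => D0.
have D : y + y + (1 - b) * x - b != 0.
  by apply: contraNneq D0 => h; rewrite -h; apply/eqP; ring.
by rewrite eqxx (negPf D) /= /neg_dbl /dbl_den /=; congr (Some (_, _)); field.
Qed.

Lemma wmul_t :
  [/\ wmul tcrv 1 (Some (0, 0)) = Some (0, 0),
      wmul tcrv 2 (Some (0, 0)) = Some (b, b ^+ 2),
      wmul tcrv 3 (Some (0, 0)) = Some (b, 0),
      wmul tcrv 4 (Some (0, 0)) = Some (0, b) &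
      wmul tcrv 5 (Some (0, 0)) = None].
Proof.
pose t : wpoint K := Some (0, 0).
have t2 : wadd tcrv t t = Some (b, b ^+ 2).
  rewrite /t /= eqxx (_ : 0 + 0 + (1 - b) * 0 - b = - b); last by ring.
  by rewrite oppr_eq0 (negPf b0) /=; congr (Some (_, _)); field; rewrite ?oppr_eq0 b0.
have t3 : wadd tcrv t (Some (b, b ^+ 2)) = Some (b, 0).
  by rewrite /t wadd_neq 1?eq_sym //; congr (Some (_, _)) => /=; field; rewrite ?oppr_eq0 b0.
have t4 : wadd tcrv t (Some (b, 0)) = Some (0, b).
  by rewrite /t wadd_neq 1?eq_sym //; congr (Some (_, _)) => /=; field; rewrite ?oppr_eq0 b0.
have t5 : wadd tcrv t (Some (0, b)) = None.
  by rewrite /= eqxx (_ : 0 + b + (1 - b) * 0 - b = 0) ?eqxx //; ring.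
have w2 : wmul tcrv 2 t = Some (b, b ^+ 2) by exact: t2.
have w3 : wmul tcrv 3 t = Some (b, 0) by rewrite [LHS](congr1 (wadd tcrv t) w2).
have w4 : wmul tcrv 4 t = Some (0, b) by rewrite [LHS](congr1 (wadd tcrv t) w3).
by split=> //; rewrite [LHS](congr1 (wadd tcrv t) w4).
Qed.

(** The multiples of -2t = 3t. *)
Lemma wmul_3t :
  [/\ wmul tcrv 1 (Some (b, 0)) = Some (b, 0),
      wmul tcrv 2 (Some (b, 0)) = Some (0, 0),
      wmul tcrv 3 (Some (b, 0)) = Some (0, b) &
      wmul tcrv 4 (Some (b, 0)) = Some (b, b ^+ 2)].
Proof.
pose t : wpoint K := Some (b, 0).
have t2 : wadd tcrv t t = Some (0, 0).
  have D0 : (1 - b) * b - b != 0.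
    by rewrite (_ : _ - b = - b ^+ 2) ?oppr_eq0 ?expf_neq0 //; ring.
  rewrite /t /= eqxx !add0r (negPf D0) /=.
  by congr (Some (_, _)); field; exact: D0.
have t3 : wadd tcrv t (Some (0, 0)) = Some (0, b).
  by rewrite /t wadd_neq //; congr (Some (_, _)) => /=; field; rewrite ?oppr_eq0 ?b0.
have t4 : wadd tcrv t (Some (0, b)) = Some (b, b ^+ 2).
  by rewrite /t wadd_neq //; congr (Some (_, _)) => /=; field; rewrite ?oppr_eq0 ?b0.
have w2 : wmul tcrv 2 t = Some (0, 0) by exact: t2.
have w3 : wmul tcrv 3 t = Some (0, b) by rewrite [LHS](congr1 (wadd tcrv t) w2).
by split=> //; rewrite [LHS](congr1 (wadd tcrv t) w3).
Qed.

End TateCurve.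

(** * The pentagon map on a Tate curve *)

Section Meet.
Variable K : fieldType.
Notation x0 v := (v 0 (inord 0)).
Notation x1 v := (v 0 (inord 1)).
Notation x2 v := (v 0 (inord 2)).

(** The last coordinate of the meet of the lines AB and CD, which vanishes when they
    are parallel or equal. *)
Definition meet_den (A B C D : K * K) : K :=
  (A.2 - B.2) * (D.1 - C.1) - (B.1 - A.1) * (C.2 - D.2).

(** As R lies on both lines, it is their meet, and only the factor of proportionality
    remains to be read off from the last coordinate. *)
Lemma cross_cross_meet (A B C D R : K * K) :
    det3 A B R = 0 -> det3 C D R = 0 ->
  let v P := vec_of (Some P) in
  cross (cross (v A) (v B)) (cross (v C) (v D)) =
    meet_den A B C D *: v R.
Proof.
move=> E F v; have vE (P : K * K) := vec_of_affE P; rewrite -/(v _) /= in vE.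
have cE (P Q : K * K) : [/\ x0 (cross (v P) (v Q)) = P.2 - Q.2,
    x1 (cross (v P) (v Q)) = Q.1 - P.1 & x2 (cross (v P) (v Q)) = P.1 * Q.2 - P.2 * Q.1].
  by have [-> -> ->] := crossE (v P) (v Q); have [-> -> ->] := vE P;
     have [-> -> ->] := vE Q; rewrite !mul1r !mulr1.
have [eAB1 eAB2 eAB3] := cE A B; have [eCD1 eCD2 eCD3] := cE C D.
have EAB : A.1 * B.2 - A.2 * B.1 = - ((A.2 - B.2) * R.1 + (B.1 - A.1) * R.2).
  by apply/eqP; rewrite -subr_eq0 -E /det3; apply/eqP; ring.
have ECD : C.1 * D.2 - C.2 * D.1 = - ((C.2 - D.2) * R.1 + (D.1 - C.1) * R.2).
  by apply/eqP; rewrite -subr_eq0 -F /det3; apply/eqP; ring.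
have [c0 c1 c2] := crossE (cross (v A) (v B)) (cross (v C) (v D)).
have [r0 r1 r2] := vE R.
by apply: row3P; rewrite ?c0 ?c1 ?c2 [RHS]mxE ?r0 ?r1 ?r2
  ?eAB1 ?eAB2 ?eAB3 ?eCD1 ?eCD2 ?eCD3 ?EAB ?ECD /meet_den; ring.
Qed.

End Meet.

Section PsiTate.
Variables (K : fieldType) (b : K).
Hypothesis b0 : b != 0.

Definition tate (P : K * K) : triple K :=
  Triple (tcrv b) (vec_of (Some P)) (vec_of (Some (0, 0))).

Definition tau_pt P (m : nat) : K * K := iter m (tau b) P.

Definition pent_den P (m : nat) : K :=
  let Q := tau_pt P in
  meet_den (Q (m + 1)%N) (Q (m + 4)%N) (Q (m + 2)%N) (Q (m + 3)%N).

(** The points p for which the doubling of all p + mt, the addition of multiples of t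
    to p and -2p, and the meets of the lines are given by the generic formulas. *)
Definition generic_point P : Prop :=
  [/\ off_torsion b P, forall m, dbl_den b (tau_pt P m) != 0,
      off_torsion b (neg_dbl b P) & forall m, pent_den P m != 0].

Lemma off_torsion_iter P m : off_torsion b P -> off_torsion b (tau_pt P m).
Proof. by move=> NP; elim: m => //= m; apply: off_torsion_tau. Qed.

Lemma triple_points_tate P j : off_torsion b P ->
  triple_points (tate P) j = vec_of (Some (tau_pt P (j : 'I_5))).
Proof.
move=> NP; rewrite /triple_points [tpoint _]/= [ttors _]/= [tcurve _]/= !vec_ofK; congr vec_of.
have [w1 w2 w3 w4 _] := wmul_t b0.
case: j => [[|[|[|[|[|]]]]] j5] //; rewrite [nat_of_ord _]/=; first by case: (P).
- by rewrite w1 wadd_t.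
- by rewrite w2 wadd_2t.
- by rewrite w3 wadd_3t.
- by rewrite w4 wadd_4t.
Qed.

Lemma tau_pt5 P m : off_torsion b P -> tau_pt P (m + 5) = tau_pt P m.
Proof. by move=> NP; rewrite /tau_pt iterD /= tau5. Qed.

Lemma neg_dbl_tau_pt P m : generic_point P ->
  neg_dbl b (tau_pt P m) = tau_pt (neg_dbl b P) (3 * m).
Proof.
case=> NP D0 NR _; elim: m => // m IH; rewrite mulnS [RHS](iterD 3) -/(tau_pt (neg_dbl b P) (3 * m)) -IH.
apply: neg_dbl_tau => //; first exact: off_torsion_iter.
- exact: (D0 m.+1).
- by rewrite IH; apply: off_torsion_iter.
Qed.

(** Here -2p + m (-2t) is rewritten as -2(p + mt). *)
Lemma triple_points_mulN2 P j : generic_point P ->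
  triple_points (triple_mulN2 (tate P)) j =
    vec_of (Some (neg_dbl b (tau_pt P (j : 'I_5)))).
Proof.
move=> gP; rewrite neg_dbl_tau_pt //; have [NP D0 NR _] := gP.
have -> : triple_mulN2 (tate P) =
    Triple (tcrv b) (vec_of (Some (neg_dbl b P))) (vec_of (Some (b, 0))).
  have [_ w2 _ _ _] := wmul_t b0.
  congr (Triple _ (vec_of _) (vec_of _)); rewrite vec_ofK.
    by rewrite -(wadd_dbl (D0 0)); case: (P).
  by rewrite w2; congr (Some (_, _)) => /=; ring.
rewrite /triple_points [tpoint _]/= [ttors _]/= [tcurve _]/= !vec_ofK; congr vec_of.
have [u1 u2 u3 u4] := wmul_3t b0.
case: j => [[|[|[|[|[|]]]]] j5] //; rewrite [nat_of_ord _]/=.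
- by rewrite u1 wadd_3t.
- by rewrite u2 wadd_t // (tau_pt5 1 NR).
- by rewrite u3 wadd_4t // (tau_pt5 4 NR).
- by rewrite u4 wadd_2t // (tau_pt5 7 NR) (tau_pt5 2 NR).
Qed.

(** The new vertex m is the meet of the line through p + (m + 1) t and p + (m - 1) t
    with the line through p + (m + 2) t and p + (m - 2) t; both contain -2(p + mt). *)
Lemma Psi_tate P : generic_point P ->
  arr_equiv (Psi (triple_points (tate P))) (triple_points (triple_mulN2 (tate P))).
Proof.
move=> gP; have [NP D0 NR S0] := gP.
exists 1%:M => [|j]; first exact: unitmx1.
rewrite mulmx1 triple_points_mulN2 //.
suff [s s0 ->] : exists2 s, s != 0 &
    Psi (triple_points (tate P)) j = s *: vec_of (Some (neg_dbl b (tau_pt P (j : 'I_5)))).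
  by exists s^-1; rewrite ?invr_neq0 // scalerA mulVf ?scale1r.
have meet m : let v i := vec_of (Some (tau_pt P (m + i))) in
    cross (cross (v 1%N) (v 4%N)) (cross (v 2%N) (v 3%N)) =
    pent_den P m *: vec_of (Some (neg_dbl b (tau_pt P m))).
  have NQ : off_torsion b (tau_pt P m) by apply: off_torsion_iter.
  have tauD i : tau_pt P (m + i) = tau_pt (tau_pt P m) i.
    by rewrite addnC /tau_pt iterD.
  rewrite /= /pent_den !tauD; apply: cross_cross_meet.
    exact: neg_dbl_collinear1.
  exact: neg_dbl_collinear2.
have tpE (i : 'Z_5) k : i = k :> nat ->
    triple_points (tate P) i = vec_of (Some (tau_pt P k)).
  by move=> <-; exact: triple_points_tate.
(* Up to the order of the two lines and of the points on them, hence up to a sign,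
   the five lines of the definition are those of [meet]. *)
rewrite /Psi /dual_op /Lambda (tpE 1 1%N) // (tpE 2 2%N) // (tpE 3 3%N) //
  (tpE 4 4%N) // (tpE 5 0%N) //.
case: j => [[|[|[|[|[|]]]]] j5] //; rewrite [nat_of_ord _]/= [nth _ _ _]/=.
- by exists (pent_den P 0) => //; exact: (meet 0).
- exists (- pent_den P 1); rewrite ?oppr_eq0 // scaleNr -meet.
  by rewrite (tau_pt5 0 NP) crossC.
- exists (- pent_den P 2); rewrite ?oppr_eq0 // scaleNr -meet.
  by rewrite (tau_pt5 0 NP) (tau_pt5 1 NP) [in RHS](crossC (vec_of (Some (tau_pt P 3)))) crossNl opprK.
- exists (- pent_den P 3); rewrite ?oppr_eq0 // scaleNr -meet.
  rewrite (tau_pt5 0 NP) (tau_pt5 1 NP) (tau_pt5 2 NP) crossC; congr (- _).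
  by rewrite crossC -crossNl -crossC crossC -crossNl -crossC.
- exists (pent_den P 4) => //; rewrite -meet (tau_pt5 0 NP) (tau_pt5 1 NP)
    (tau_pt5 2 NP) (tau_pt5 3 NP).
  by rewrite crossC -crossNl -crossC.
Qed.

End PsiTate.

(** * Tate normal form *)

Section TateNormalForm.
Variable K : fieldType.
Hypothesis two0 : 2 != 0 :> K.
Implicit Types T : triple K.

Lemma triple_points_iso T T' :
    on_curve (tcurve T') (tpoint T') -> on_curve (tcurve T') (ttors T') ->
    triple_iso T T' ->
  arr_equiv (triple_points T') (triple_points T) /\
  arr_equiv (triple_points (triple_mulN2 T')) (triple_points (triple_mulN2 T)).
Proof.
move=> /on_curve_point_of op /on_curve_point_of ot.
move=> /(triple_iso_change _ _ two0)[u [r [s [w [u0 eE ep et]]]]].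
rewrite eE in op ot.
have mc T0 : tcurve (triple_mulN2 T0) = tcurve T0 by [].
have mp T0 : point_of (tpoint (triple_mulN2 T0)) =
    wneg (tcurve T0) (wmul (tcurve T0) 2 (point_of (tpoint T0))) by exact: vec_ofK.
have mt T0 : point_of (ttors (triple_mulN2 T0)) =
    wneg (tcurve T0) (wmul (tcurve T0) 2 (point_of (ttors T0))) by exact: vec_ofK.
have neg_on E P : on_wcurve E P -> on_wcurve E (wneg E P).
  by case: P => [[x y]|] //; rewrite /on_wcurve /weq /= => h; rewrite -[RHS]h; ring.
split; exists (change_mx u r s w); rewrite ?change_mx_unit // => i; rewrite /triple_points.
  rewrite ep et eE wmul_change // wadd_change //; last exact: wmul_on_wcurve.
  exact: vec_of_change.
have on2 P : on_wcurve (wcurve_change u r s w (tcurve T)) P ->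
  on_wcurve (wcurve_change u r s w (tcurve T))
    (wneg (wcurve_change u r s w (tcurve T)) (wmul (wcurve_change u r s w (tcurve T)) 2 P)).
  by move=> oP; apply/neg_on/wmul_on_wcurve.
rewrite !mp !mt !mc ep et eE !wmul_change // !wneg_change // wmul_change; [|by []|exact: on2].
rewrite wadd_change //; first exact: vec_of_change.
- exact: on2.
- exact/wmul_on_wcurve/on2.
Qed.

Section TorsionOfOrderFive.
Variable (E : wcurve K).

(** If 2t = 0, then 5t = t. *)
Lemma torsion5_not2 (P : K * K) : wmul E 5 (Some P) = None ->
  2 * P.2 + a1 E * P.1 + a3 E != 0.
Proof.
case: P => x y H; apply/eqP => /= D.
suff : wmul E 5 (Some (x, y)) = Some (x, y) by rewrite H.
have t2 : wadd E (Some (x, y)) (Some (x, y)) = None.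
  by rewrite /= eqxx (_ : y + y + _ + _ = 0) ?eqxx // -D; ring.
have w2 : wmul E 2 (Some (x, y)) = None by exact: t2.
have w4 : wmul E 4 (Some (x, y)) = None.
  by rewrite [LHS](congr1 (fun Q => wadd E (Some (x, y)) (wadd E (Some (x, y)) Q)) w2).
by rewrite [LHS](congr1 (wadd E (Some (x, y))) w4).
Qed.

Hypotheses (a4E : a4 E = 0) (a30 : a3 E != 0).
Let t : wpoint K := Some (0, 0).
Hypothesis t5 : wmul E 5 t = None.

Let t2 : wadd E t t = Some (- a2 E, a1 E * a2 E - a3 E).
Proof.
rewrite /t /= eqxx !mulr0 !add0r (negPf a30) /= a4E.
by congr (Some (_, _)); field; exact: a30.
Qed.

Let w2 : wmul E 2 t = Some (- a2 E, a1 E * a2 E - a3 E).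
Proof. exact: t2. Qed.

(** The tangent at t is y = 0. If a2 = 0, it meets the curve only at t, so that
    3t = 0 and 5t = 2t. *)
Lemma torsion5_not3 : a2 E != 0.
Proof.
apply/eqP => a20.
have w2' : wmul E 2 t = Some (0, - a3 E) by rewrite w2 a20; congr (Some (_, _)); ring.
have t3 : wadd E t (Some (0, - a3 E)) = None.
  by rewrite /t /= eqxx mulr0 addr0 add0r addNr eqxx.
have w3 : wmul E 3 t = None by rewrite [LHS](congr1 (wadd E t) w2').
have w4 : wmul E 4 t = t by rewrite [LHS](congr1 (wadd E t) w3).
have := t5; rewrite [LHS](congr1 (wadd E t) w4) t2.
by [].
Qed.

(** With c = 1 - a1 one finds 3t = (c, b - c) and x(4t) = (b - c) b / c ^+ 2, which
    must be the abscissa 0 of -t. *)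
Lemma torsion5_tate b : a2 E = - b -> a3 E = - b -> a1 E = 1 - b.
Proof.
move=> a2E a3E; set c := 1 - a1 E.
have b0 : b != 0 by rewrite -oppr_eq0 -a3E.
suff -> : b = c by rewrite /c; ring.
have w2' : wmul E 2 t = Some (b, b * c).
  by rewrite w2 a2E a3E /c; congr (Some (_, _)); ring.
have t3 : wadd E t (Some (b, b * c)) = Some (c, b - c).
  rewrite /t wadd_neq 1?eq_sym // a2E a3E (_ : a1 E = 1 - c); last by rewrite /c; ring.
  by congr (Some (_, _)) => /=; field; exact: b0.
have w3 : wmul E 3 t = Some (c, b - c) by rewrite [LHS](congr1 (wadd E t) w2').
have [c0|c0] := eqVneq c 0.
  have t4 : wadd E t (Some (c, b - c)) = None.
    by rewrite c0 /= eqxx a3E (_ : _ - b = 0) ?eqxx //; ring.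
  have w4 : wmul E 4 t = None by rewrite [LHS](congr1 (wadd E t) w3).
  by have := t5; rewrite [LHS](congr1 (wadd E t) w4).
have t4 : exists y, wadd E t (Some (c, b - c)) = Some ((b - c) * b / c ^+ 2, y).
  rewrite /t wadd_neq 1?eq_sym // a2E a3E (_ : a1 E = 1 - c); last by rewrite /c; ring.
  by eexists; congr (Some (_, _)) => /=; field; exact: c0.
case: t4 => y t4.
have w4 : wmul E 4 t = Some ((b - c) * b / c ^+ 2, y) by rewrite [LHS](congr1 (wadd E t) w3).
have := t5; rewrite [LHS](congr1 (wadd E t) w4) /t /=.
case: eqP => //= e _; apply/eqP; rewrite -subr_eq0.
have /eqP : (b - c) * b / c ^+ 2 = 0 by rewrite -e.
by rewrite !mulf_eq0 invr_eq0 expf_eq0 /= (negPf b0) (negPf c0) !orbF.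
Qed.

End TorsionOfOrderFive.

(** The change of coordinates to Tate's normal form moves t to the origin and the
    tangent at t to y = 0; the scale [tate_u] then makes a2 and a3 equal. *)
Definition tors_x T := ttors T 0 (inord 0) / ttors T 0 (inord 2).
Definition tors_y T := ttors T 0 (inord 1) / ttors T 0 (inord 2).
Definition tate_d T :=
  2 * tors_y T + a1 (tcurve T) * tors_x T + a3 (tcurve T).
Definition tate_s T :=
  (3 * tors_x T ^+ 2 + 2 * a2 (tcurve T) * tors_x T + a4 (tcurve T)
     - a1 (tcurve T) * tors_y T) / tate_d T.
Definition tate_a2 T :=
  a2 (tcurve T) - tate_s T * a1 (tcurve T) + 3 * tors_x T - tate_s T ^+ 2.
Definition tate_u T := tate_d T / tate_a2 T.
Definition tate_b T := - tate_a2 T ^+ 3 / tate_d T ^+ 2.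
Definition tate_pt T (P : K * K) : K * K :=
  ((P.1 - tors_x T) / tate_u T ^+ 2,
   (P.2 - tors_y T - tate_s T * (P.1 - tors_x T)) / tate_u T ^+ 3).

Lemma tate_normal_form T : is_triple T ->
  [/\ ttors T 0 (inord 2) != 0, tate_d T != 0, tate_a2 T != 0 &
   triple_iso T (Triple (tcrv (tate_b T)) (vec_of (omap (tate_pt T) (point_of (tpoint T))))
                   (vec_of (Some (0, 0))))].
Proof.
case=> disc0 op ot; rewrite {1}/point_of.
case: ifPn => // z0 _ t5.
have tE : point_of (ttors T) = Some (tors_x T, tors_y T).
  by rewrite /point_of (negPf z0).
rewrite tE in t5.
have d0 : tate_d T != 0 by apply: torsion5_not2 t5.
have := on_curve_point_of ot; rewrite tE => ot'.
set E := tcurve T in ot' t5.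
have sd : tate_s T * tate_d T = 3 * tors_x T ^+ 2 + 2 * a2 E * tors_x T + a4 E - a1 E * tors_y T.
  by rewrite /tate_s divfK.
have chE u : u != 0 -> let E' := wcurve_change u (tors_x T) (tate_s T) (tors_y T) E in
    [/\ a4 E' = 0, a6 E' = 0 & wmul E' 5 (Some (0, 0)) = None].
  move=> u0 E'.
  have tch : Some (tors_x T, tors_y T) =
      wchange u (tors_x T) (tate_s T) (tors_y T) (Some (0, 0)).
    by congr (Some (_, _)); ring.
  have o0 : on_wcurve E' (Some (0, 0)) by apply/on_wcurve_change; rewrite // -tch.
  split.
  - rewrite /E' /= (_ : _ - _ = 3 * tors_x T ^+ 2 + 2 * a2 E * tors_x T + a4 E
      - a1 E * tors_y T - tate_s T * tate_d T); last by rewrite /tate_d -/E; ring.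
    by rewrite sd subrr mul0r.
  - by move: o0; rewrite /on_wcurve /weq => o0; apply: oppr_inj; rewrite oppr0 -[RHS]o0; ring.
  - have := t5; rewrite tch wmul_change //.
    by case: (wmul _ _ _) => [[]|].
have a20 : tate_a2 T != 0.
  have [e4 e6 e5] := chE 1 (oner_neq0 _).
  have := torsion5_not3 e4 _ e5; rewrite /= !expr1n !divr1 -/(tate_a2 T); apply.
  by rewrite -mulrC (_ : _ + _ = tate_d T) // /tate_d -/E; ring.
have u0 : tate_u T != 0 by rewrite mulf_neq0 ?invr_neq0.
split=> //; apply/(triple_iso_change _ _ two0).
exists (tate_u T), (tors_x T), (tate_s T), (tors_y T).
rewrite /= !vec_ofK tE -/E; split=> //.
- have [e4 e6 e5] := chE _ u0.
  set E' := wcurve_change _ _ _ _ _ in e4 e6 e5 *.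
  have e2 : a2 E' = - tate_b T.
    rewrite /E' /= -/(tate_a2 T) /tate_b /tate_u; by field; rewrite d0 a20.
  have e3 : a3 E' = - tate_b T.
    rewrite /E' /= (_ : _ + 2 * _ = tate_d T); last by rewrite /tate_d -/E; ring.
    by rewrite /tate_b /tate_u; field; rewrite d0 a20.
  have b0 : tate_b T != 0.
    by rewrite mulf_neq0 ?oppr_eq0 ?invr_neq0 ?expf_neq0.
  have a30 : a3 E' != 0 by rewrite e3 oppr_eq0.
  have e1 := torsion5_tate e4 a30 e5 e2 e3.
  by case: E' e1 e2 e3 e4 e6 {e5 a30} => ? ? ? ? ? /= -> -> -> -> ->.
- case: (point_of _) => [[x y]|] //=; congr (Some (_, _)); field; exact: u0.
- by congr (Some (_, _)); ring.
Qed.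

End TateNormalForm.

(** * Rigidity and the pencil of Tate curves *)

Section TateTriples.
Variable K : fieldType.
Hypothesis two0 : 2 != 0 :> K.

Lemma wdisc_tcrv (b : K) : wdisc (tcrv b) = b ^+ 5 * (b ^+ 2 - 11 * b - 1).
Proof. by rewrite /wdisc /=; ring. Qed.

Lemma is_triple_tate (b : K) v : is_triple (Triple (tcrv b) v (vec_of (Some (0, 0)))) <->
  wdisc (tcrv b) != 0 /\ on_curve (tcrv b) v.
Proof.
split=> [[]|[d0 ov]] //; split=> //=; rewrite ?vec_ofK //.
  by apply: on_curve_vec_of; rewrite /on_wcurve /weq /=; ring.
have b0 : b != 0.
  by apply: contraNneq d0 => ->; rewrite wdisc_tcrv expr0n mul0r.
by have [] := wmul_t b0.
Qed.

Lemma on_tateE (b : K) (P : K * K) : on_tate b P <-> on_wcurve (tcrv b) (Some P).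
Proof.
case: P => x y; rewrite /on_tate /on_wcurve /weq /=; split=> [E|E].
  by ring: E.
by apply/eqP; rewrite -subr_eq0 -E; apply/eqP; ring.
Qed.

(** A Tate curve with its marked points has no nontrivial change of coordinates. *)
Lemma tate_rigid (b b' : K) v v' : b != 0 -> b' != 0 ->
    triple_iso (Triple (tcrv b) v (vec_of (Some (0, 0))))
               (Triple (tcrv b') v' (vec_of (Some (0, 0)))) ->
  b = b' /\ point_of v = point_of v'.
Proof.
move=> b0 b'0 /(triple_iso_change _ _ two0)[u [r [s [w [u0]]]]].
rewrite /= !vec_ofK => eE ep [er ew].
have r0 : r = 0 by rewrite er; ring.
have w0 : w = 0 by rewrite ew; ring.
move: eE ep; rewrite r0 w0 /wcurve_change /= => -[_ e2 e3 e4 _] ep.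
have s0 : s = 0.
  apply: (mulIf b0); rewrite mul0r; apply: (mulIf (invr_neq0 (expf_neq0 4 u0))).
  by rewrite mul0r [RHS]e4; field; exact: u0.
rewrite s0 in e2 ep.
have bu2 : b = b' * u ^+ 2.
  apply: oppr_inj; rewrite -mulNr e2; field; exact: u0.
have bu3 : b = b' * u ^+ 3.
  apply: oppr_inj; rewrite -mulNr e3; field; exact: u0.
have u1 : u = 1.
  apply: (mulfI (mulf_neq0 b'0 (expf_neq0 2 u0))).
  by rewrite mulr1 -[RHS]bu2 [RHS]bu3; ring.
split; first by rewrite bu2 u1 expr1n mulr1.
by rewrite ep u1; case: (point_of v') => [[x y]|] //=; congr (Some (_, _)); ring.
Qed.

(** The equation of the Tate curve is linear in b: it reads b q = n. *)
Definition tate_q (P : K * K) : K := P.1 ^+ 2 - P.1 * P.2 - P.2.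
Definition tate_n (P : K * K) : K := P.1 ^+ 3 - P.2 ^+ 2 - P.1 * P.2.
Definition tate_param (P : K * K) : K := tate_n P / tate_q P.

Lemma on_tate_param b (P : K * K) : tate_q P != 0 -> on_tate b P <-> b = tate_param P.
Proof.
move=> q0; have e : b * tate_q P = tate_n P <-> on_tate b P.
  rewrite /on_tate /tate_q /tate_n; split=> E; apply/eqP; rewrite -subr_eq0.
    by move/eqP: E; rewrite -subr_eq0 => /eqP <-; apply/eqP; ring.
  by move/eqP: E; rewrite -subr_eq0 => /eqP <-; apply/eqP; ring.
rewrite -e /tate_param; split=> [<-|->]; by [rewrite mulfK | rewrite divfK].
Qed.

(** The base points of the pencil of Tate curves are the origin and the flex. *)
Lemma on_tate_q0 b (P : K * K) : b != 0 -> on_tate b P -> tate_q P = 0 -> P = (0, 0).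
Proof.
case: P => x y b0; rewrite /on_tate /tate_q /= => E q0.
have n0 : x ^+ 3 - y ^+ 2 - x * y = 0.
  rewrite E -[RHS](mulr0 b) -q0; ring.
(* The elimination of y from q = n = 0 leaves x ^+ 5 = 0. *)
have h : y * (1 + x) = x ^+ 2 by rewrite -[LHS]addr0 -q0; ring.
have x0 : x ^+ 5 = 0.
  transitivity (x ^+ 3 * (1 + x) ^+ 2 - (y * (1 + x)) ^+ 2 - x * (y * (1 + x)) * (1 + x)).
    by rewrite h; ring.
  by rewrite -(mulr0 ((1 + x) ^+ 2)) -n0; ring.
move/eqP: x0; rewrite expf_eq0 /= => /eqP x0; rewrite x0 in h *.
by congr (_, _); rewrite -[LHS]mulr1 -[1]addr0 h expr0n.
Qed.

End TateTriples.

Section CoordinateFunctions.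
Variable K : fieldType.
Implicit Types U : car (Xi1_5_open K) -> Prop.

Lemma coord_Xi1_5 (T : triple K) (i : 'I_5) (j : 'I_3) :
  [/\ Defs.coord (q := Xi1_5_open K) T 0 (lshift _ i) =
       nth 0 [:: a1 (tcurve T); a2 (tcurve T); a3 (tcurve T); a4 (tcurve T); a6 (tcurve T)] i,
      Defs.coord (q := Xi1_5_open K) T 0 (rshift _ (lshift _ j)) = tpoint T 0 j &
      Defs.coord (q := Xi1_5_open K) T 0 (rshift _ (rshift _ j)) = ttors T 0 j].
Proof. by split; rewrite /= ?row_mxEl ?row_mxEr ?row_mxEl ?row_mxEr ?mxE. Qed.

Lemma lregular_wcoef U :
  [/\ lregular U (fun T => a1 (tcurve T)), lregular U (fun T => a2 (tcurve T)),
      lregular U (fun T => a3 (tcurve T)), lregular U (fun T => a4 (tcurve T)) &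
      lregular U (fun T => a6 (tcurve T))].
Proof.
have e (i : 'I_5) : lregular U (fun T =>
    nth 0 [:: a1 (tcurve T); a2 (tcurve T); a3 (tcurve T); a4 (tcurve T); a6 (tcurve T)] i).
  apply: lregular_ext (lregular_coord (U := U) (lshift _ i)) => T _.
  by have [-> _ _] := coord_Xi1_5 T i ord0.
split; [have := e (inord 0)|have := e (inord 1)|have := e (inord 2)|
  have := e (inord 3)|have := e (inord 4)]; by rewrite inordK.
Qed.

Lemma lregular_tpoint U j : lregular U (fun T => tpoint T 0 j).
Proof.
apply: lregular_ext (lregular_coord (U := U) (rshift _ (lshift _ j))) => T _.
by have [_ -> _] := coord_Xi1_5 T ord0 j.
Qed.

Lemma lregular_ttors U j : lregular U (fun T => ttors T 0 j).
Proof.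
apply: lregular_ext (lregular_coord (U := U) (rshift _ (rshift _ j))) => T _.
by have [_ _ ->] := coord_Xi1_5 T ord0 j.
Qed.

End CoordinateFunctions.

(** * The chart of the surface of triples *)

Section NormalForm.
Variable K : fieldType.
Hypothesis two0 : 2 != 0 :> K.

Definition tate_normal (T : triple K) : triple K :=
  Triple (tcrv (tate_b T)) (vec_of (omap (tate_pt T) (point_of (tpoint T))))
    (vec_of (Some (0, 0))).

Lemma tate_normal_iso T : is_triple T -> triple_iso T (tate_normal T).
Proof. by case/(tate_normal_form two0). Qed.

Lemma tate_normal_triple T : is_triple T -> is_triple (tate_normal T).
Proof.
move=> iT; have := tate_normal_iso iT.
move=> /(triple_iso_change _ _ two0)[u [r [s [w [u0 eE ep et]]]]].
have [d0 op _ _ _] := iT.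
apply/is_triple_tate; split.
  by move: d0; rewrite (wdisc_change r s w _ u0) -eE mulf_eq0 negb_or => /andP[].
apply: on_curve_vec_of; have := on_curve_point_of op.
rewrite {1}ep => /(on_wcurve_change _ _ _ _ u0); rewrite -eE.
by rewrite (vec_ofK _ : point_of (tpoint (tate_normal T)) = _).
Qed.

Lemma wdisc_tcrv_neq0 (b : K) : wdisc (tcrv b) != 0 -> b != 0.
Proof. by apply: contraNneq => ->; rewrite wdisc_tcrv expr0n mul0r. Qed.

Definition tate_xy (T : triple K) : K * K :=
  tate_pt T (tpoint T 0 (inord 0) / tpoint T 0 (inord 2),
             tpoint T 0 (inord 1) / tpoint T 0 (inord 2)).

Definition affine_triple (T : triple K) : Prop :=
  is_triple T /\ tpoint T 0 (inord 2) != 0.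

Lemma tate_normal_affine T : tpoint T 0 (inord 2) != 0 ->
  tate_normal T = tate (tate_b T) (tate_xy T).
Proof. by move=> z0; rewrite /tate_normal /point_of (negPf z0). Qed.

Lemma affine_tripleP T : affine_triple T ->
  [/\ triple_iso T (tate (tate_b T) (tate_xy T)), wdisc (tcrv (tate_b T)) != 0 &
      on_tate (tate_b T) (tate_xy T)].
Proof.
case=> iT z0; have := tate_normal_iso iT; have := tate_normal_triple iT.
rewrite tate_normal_affine // => /is_triple_tate[d0 /on_curve_point_of op] iso.
by split=> //; apply/on_tateE; rewrite vec_ofK in op.
Qed.

Lemma point_of_None (v : 'rV[K]_3) : (point_of v == None) = (v 0 (inord 2) == 0).
Proof. by rewrite /point_of; case: ifP. Qed.

(** Isomorphic triples have isomorphic Tate forms, which are equal by [tate_rigid]: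
    the coordinates of p in Tate form are invariants. *)
Lemma triple_iso_affine T T' : affine_triple T -> is_triple T' -> triple_iso T T' ->
  [/\ affine_triple T', tate_b T = tate_b T' & tate_xy T = tate_xy T'].
Proof.
move=> aT iT' TT'; have aT' : affine_triple T'.
  split=> //; rewrite -point_of_None; case: aT => _; rewrite -point_of_None.
  case: TT' => [u [r [s [w [_ _ -> _]]]]].
  by case: (point_of _).
have [iso d0 on] := affine_tripleP aT; have [iso' d0' on'] := affine_tripleP aT'.
have [_ sym tr] := triple_iso_equivalence K.
have := tr _ _ _ (sym _ _ iso) (tr _ _ _ TT' iso').
case/(tate_rigid two0 (wdisc_tcrv_neq0 d0) (wdisc_tcrv_neq0 d0')) => -> e; split=> //.
by apply: Some_inj; rewrite -[LHS]vec_ofK -[RHS]vec_ofK.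
Qed.

Section Regularity.
Variable U : car (Xi1_5_open K) -> Prop.
Hypothesis Uaff : forall T, U T -> affine_triple T.

Lemma lregular_tate : lregular U (@tate_b K) /\
  lregular U (fun T => (tate_xy T).1) /\ lregular U (fun T => (tate_xy T).2).
Proof.
have nz T (UT : U T) : [/\ ttors T 0 (inord 2) != 0, tate_d T != 0, tate_a2 T != 0 &
                       tpoint T 0 (inord 2) != 0].
  by have [/(tate_normal_form two0)[? ? ? _] ?] := Uaff UT.
have [r1 r2 r3 r4 _] := lregular_wcoef U.
have rV h : (forall T, U T -> h T != 0) -> lregular U h -> lregular U (fun T => (h T)^-1).
  exact: lregularV.
have rt2 : lregular U (fun T => (ttors T 0 (inord 2))^-1).
  by apply: rV => [T /nz[]|] //; apply: lregular_ttors.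
have rp2 : lregular U (fun T => (tpoint T 0 (inord 2))^-1).
  by apply: rV => [T /nz[]|] //; apply: lregular_tpoint.
have rx : lregular U (@tors_x K) by apply: lregularM => //; apply: lregular_ttors.
have ry : lregular U (@tors_y K) by apply: lregularM => //; apply: lregular_ttors.
have rd : lregular U (@tate_d K).
  by rewrite /tate_d; lreg.
have rdV : lregular U (fun T => (tate_d T)^-1) by apply: rV => // T /nz[].
have rs : lregular U (@tate_s K).
  by rewrite /tate_s; lreg.
have ra : lregular U (@tate_a2 K).
  by rewrite /tate_a2; lreg.
have raV : lregular U (fun T => (tate_a2 T)^-1) by apply: rV => // T /nz[].
have ru : lregular U (@tate_u K) by apply: lregularM.
have unz T (UT : U T) : tate_u T != 0.
  by have [_ d0 a0 _] := nz T UT; rewrite mulf_neq0 ?invr_neq0.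
have ruV k : lregular U (fun T => (tate_u T ^+ k)^-1).
  by apply: rV => [T /unz u0|]; [rewrite expf_neq0 | apply: lregularX].
have [ru2 ru3] := (ruV 2%N, ruV 3%N).
have rp k : lregular U (fun T => tpoint T 0 (inord k)) by exact: lregular_tpoint.
have [rp0 rp1] := (rp 0%N, rp 1%N).
split; last split.
- apply: lregularM; first by apply/lregularN/lregularX.
  by apply: rV => [T /nz[_ d0 _ _]|]; [rewrite expf_neq0 | apply: lregularX].
- by rewrite /tate_xy /tate_pt /=; lreg.
- by rewrite /tate_xy /tate_pt /=; lreg.
Qed.

End Regularity.

Lemma zopen_affine : zopen (X := Xi1_5_open K) affine_triple.
Proof.
split=> [T []|T T' aT iT' TT'|T [iT z0]] //.
  by have [] := triple_iso_affine aT iT' TT'.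
exists 'X_(rshift _ (lshift _ (inord 2))).
  by rewrite /pev mevalXU; have [_ -> _] := coord_Xi1_5 T ord0 (inord 2).
move=> T' iT'; rewrite /pev mevalXU; have [_ -> _] := coord_Xi1_5 T' ord0 (inord 2).
by split.
Qed.

Definition in_chart (T : triple K) : Prop := affine_triple T /\ tate_q (tate_xy T) != 0.

Lemma zopen_chart : zopen (X := Xi1_5_open K) in_chart.
Proof.
have aff T : affine_triple T -> affine_triple T by [].
apply: (@zopen_neq0 _ (Xi1_5_open K) affine_triple (fun T => tate_q (tate_xy T)) zopen_affine).
  have [_ [rx ry]] := lregular_tate aff.
  by rewrite /tate_q; lreg.
by move=> T T' aT aT' /(triple_iso_affine aT aT'.1)[_ _ ->].
Qed.

Definition tate_plane (e : 'rV[K]_2) : Prop :=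
  tate_q (plane_pt e) != 0 /\ wdisc (tcrv (tate_param (plane_pt e))) != 0.

Definition chart_of_triple (T : triple K) : 'rV[K]_2 := plane_vec (tate_xy T).
Definition triple_of_chart (e : 'rV[K]_2) : triple K :=
  tate (tate_param (plane_pt e)) (plane_pt e).

Lemma triple_of_chart_affine e : tate_plane e -> affine_triple (triple_of_chart e).
Proof.
case=> q0 d0; split; last by have [_ _ /= ->] := vec_of_affE (plane_pt e); exact: oner_neq0.
apply/is_triple_tate; split=> //; apply/on_curve_vec_of/on_tateE.
by apply/(on_tate_param _ q0).
Qed.

Lemma triple_of_chartK e : tate_plane e -> tate_xy (triple_of_chart e) = plane_pt e.
Proof.
move=> Ve; have aT := triple_of_chart_affine Ve; have [q0 d0] := Ve.
have [iso d0' on] := affine_tripleP aT.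
case/(tate_rigid two0 (wdisc_tcrv_neq0 d0) (wdisc_tcrv_neq0 d0')): iso => _.
by rewrite !vec_ofK => /Some_inj.
Qed.

Lemma tate_b_chart T : in_chart T -> tate_b T = tate_param (tate_xy T).
Proof. by case=> aT q0; apply/(on_tate_param _ q0); have [] := affine_tripleP aT. Qed.

Lemma triple_of_chart_iso T : in_chart T -> triple_iso T (triple_of_chart (chart_of_triple T)).
Proof.
move=> cT; have [aT _] := cT; have [iso _ _] := affine_tripleP aT.
by rewrite /triple_of_chart /chart_of_triple plane_vecK -tate_b_chart.
Qed.

Lemma chart_in_plane T : in_chart T -> tate_plane (chart_of_triple T).
Proof.
move=> cT; have [aT q0] := cT; have [_ d0 _] := affine_tripleP aT.
by split; rewrite /chart_of_triple plane_vecK // -tate_b_chart.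
Qed.

Lemma chart_of_triple_morphism :
  is_morphism (X := Xi1_5_open K) (Y := plane K) in_chart tate_plane chart_of_triple.
Proof.
have [_ [rx ry]] := @lregular_tate in_chart (fun T cT => cT.1).
apply: lregular_morphism => //.
- exact: zopen_chart.
- exact: chart_in_plane.
- by move=> T T' [aT _] [[iT' _] _] /(triple_iso_affine aT iT')[_ _ e]; rewrite /= /chart_of_triple e.
- move=> i; have [i0|i0] := boolP (i == ord0).
    by apply: lregular_ext rx => T _; rewrite /= /chart_of_triple mxE i0.
  by apply: lregular_ext ry => T _; rewrite /= /chart_of_triple mxE (negPf i0).
Qed.

Lemma lregular_tate_param (U : car (plane K) -> Prop) :
    (forall e, U e -> tate_q (plane_pt e) != 0) ->
  lregular U (fun e => tate_param (plane_pt e)).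
Proof.
move=> Uq; have [rx ry] := lregular_plane U.
have rq : lregular U (fun e => (tate_q (plane_pt e))^-1).
  by apply: lregularV => //; rewrite /tate_q; lreg.
by rewrite /tate_param /tate_n; lreg.
Qed.

Lemma zopen_tate_plane : zopen (X := plane K) tate_plane.
Proof.
have zq : zopen (X := plane K) (fun e => pts e /\ tate_q (plane_pt e) != 0).
  apply: (@zopen_neq0 _ (plane K) _ (fun e => tate_q (plane_pt e))).
  - exact: zopen_pts.
  - by have [rx ry] := lregular_plane (@pts _ (plane K)); rewrite /tate_q; lreg.
  - by move=> e e' _ _ ->.
apply: (zopen_ext _ (@zopen_neq0 _ (plane K) _
  (fun e => wdisc (tcrv (tate_param (plane_pt e)))) zq _ _)).
- by move=> e; split=> [[[_ q0] d0]|[q0 d0]].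
- set U := fun e => _; have rb : lregular U (fun e => tate_param (plane_pt e)).
    by apply: lregular_tate_param => e [].
  apply: (@lregular_ext _ (plane K) U (fun e => tate_param (plane_pt e) ^+ 5 *
     (tate_param (plane_pt e) ^+ 2 - 11 * tate_param (plane_pt e) - 1))); last by lreg.
  by move=> e _; rewrite wdisc_tcrv.
- by move=> e e' _ _ ->.
Qed.

Lemma triple_of_chart_morphism :
  is_morphism (X := plane K) (Y := Xi1_5_open K) tate_plane in_chart triple_of_chart.
Proof.
have rb := @lregular_tate_param tate_plane (fun e Ve => Ve.1).
have [rx ry] := lregular_plane tate_plane.
apply: lregular_morphism.
- exact: zopen_tate_plane.
- by move=> T [[]].
- move=> e Ve; split; first exact: triple_of_chart_affine.
  by rewrite triple_of_chartK //; case: Ve.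
- by move=> e e' _ _ ->; have [refl _ _] := triple_iso_equivalence K; apply: refl.
move=> i; case: (split_ordP i) => [j ->|j' ->].
  apply: (@lregular_ext _ (plane K) tate_plane
    (fun e => nth 0 [:: 1 - tate_param (plane_pt e); - tate_param (plane_pt e);
                        - tate_param (plane_pt e); 0; 0] j)).
    by move=> e _; have [-> _ _] := coord_Xi1_5 (triple_of_chart e) j ord0.
  by case: j => [[|[|[|[|[|]]]]] ?] //=; lreg.
case: (split_ordP j') => [j ->|j ->].
  apply: (@lregular_ext _ (plane K) tate_plane
    (fun e => nth 0 [:: (plane_pt e).1; (plane_pt e).2; 1] j)).
    by move=> e _; have [_ -> _] := coord_Xi1_5 (triple_of_chart e) ord0 j;
       rewrite /= mxE.
  by case: j => [[|[|[|]]] ?] //=; lreg.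
apply: (@lregular_ext _ (plane K) tate_plane (fun e => nth 0 [:: 0; 0; 1] j)).
  by move=> e _; have [_ _ ->] := coord_Xi1_5 (triple_of_chart e) ord0 j;
     rewrite /= mxE.
exact: lregularC.
Qed.

End NormalForm.

(** * Density of the chart *)

Section ChartDense.
Variable K : closedFieldType.
Hypothesis two0 : 2 != 0 :> K.

Definition tate_at (b : K) (v : 'rV[K]_3) : triple K :=
  Triple (tcrv b) v (vec_of (Some (0, 0))).

(** An open set containing one triple contains others obtained by moving p along the
    curve f = 0, when p depends polynomially on x and z. *)
Lemma tate_at_dense (b : K) (O : car (Xi1_5_open K) -> Prop)
    (w : 'rV[{poly {poly K}}]_3) (f : {poly {poly K}}) (e : {poly K}) x0 z0 :
    let v x z := map_mx (ev2 x z) w in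
    zopen O -> O (tate_at b (v x0 z0)) -> f \is monic -> ev2 x0 z0 f = 0 -> e != 0 ->
  exists x z, [/\ e.[z] != 0, ev2 x z f = 0 &
    is_triple (tate_at b (v x z)) -> O (tate_at b (v x z))].
Proof.
move=> v [_ _ On] O0 fm f0 e0; have [d d0 dO] := On _ O0.
(* The coordinates of the moving triple as polynomials in x and z. *)
pose cc (c : K) : {poly {poly K}} := c%:P%:P.
pose h := row_mx (map_mx cc (\row_(i < 5) [:: 1 - b; - b; - b; 0; 0]`_i))
   (row_mx w (map_mx cc (vec_of (Some (0, 0))))).
pose phi x z : {rmorphism {poly {poly K}} -> K} := horner_eval x \o map_poly (horner_eval z).
pose cc' : {rmorphism K -> {poly {poly K}}} := polyC \o polyC.
have ccK x z : cancel cc' (phi x z).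
  by move=> c; rewrite /= map_polyC /= /horner_eval !hornerC.
have dE x z : ev2 x z (mmap cc' (fun i => h 0 i) d) = pev (X := Xi1_5_open K) d (tate_at b (v x z)).
  rewrite -[LHS]/(phi x z _) rmorph_mmap //; apply: meval_eq => i.
  rewrite -[phi x z _]/(ev2 x z _).
  have ccE c : ev2 x z (cc c) = c by exact: ccK.
  case: (split_ordP i) => [j ->|j' ->].
    by have [-> _ _] := coord_Xi1_5 (tate_at b (v x z)) j ord0; rewrite row_mxEl !mxE ccE.
  case: (split_ordP j') => [j ->|j ->].
    by have [_ -> _] := coord_Xi1_5 (tate_at b (v x z)) ord0 j;
       rewrite row_mxEr row_mxEl !mxE.
  by have [_ _ ->] := coord_Xi1_5 (tate_at b (v x z)) ord0 j;
     rewrite row_mxEr row_mxEr !mxE ccE.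
rewrite -dE in d0.
have [x [z [ez fz dz]]] := monic_curve_dense fm f0 d0 e0.
by exists x, z; split=> // iT; apply: dO => //; rewrite -dE.
Qed.

Lemma tate_at_in_chart b (v : 'rV[K]_3) : b != 0 -> is_triple (tate_at b v) ->
    v 0 (inord 2) != 0 -> point_of v != Some (0, 0) ->
  in_chart (tate_at b v).
Proof.
move=> b0 iT z0 v0; have aT : affine_triple (tate_at b v) by [].
split=> //; have [iso d0 on] := affine_tripleP two0 aT.
have [_ e] := tate_rigid two0 b0 (wdisc_tcrv_neq0 d0) iso.
rewrite vec_ofK in e; rewrite e in v0.
apply: contraNneq v0 => q0; apply/eqP; congr Some.
exact: on_tate_q0 (wdisc_tcrv_neq0 d0) on q0.
Qed.

Lemma ev2X (x z : K) : ev2 x z 'X = x.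
Proof. by rewrite /ev2 map_polyX hornerX. Qed.
Lemma ev2C x z (p : {poly K}) : ev2 x z p%:P = p.[z].
Proof. by rewrite /ev2 map_polyC hornerC. Qed.
Lemma ev2_1 (x z : K) : ev2 x z 1 = 1.
Proof. by rewrite /ev2 rmorph1 hornerC. Qed.
Lemma ev2Xn x z (P : {poly {poly K}}) k : ev2 x z (P ^+ k) = ev2 x z P ^+ k.
Proof. by rewrite /ev2 rmorphXn horner_exp. Qed.
Lemma ev2D x z (P Q : {poly {poly K}}) : ev2 x z (P + Q) = ev2 x z P + ev2 x z Q.
Proof. by rewrite /ev2 rmorphD hornerD. Qed.
Lemma ev2M x z (P Q : {poly {poly K}}) : ev2 x z (P * Q) = ev2 x z P * ev2 x z Q.
Proof. by rewrite /ev2 rmorphM hornerM. Qed.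

(** A form in which monicity depends only on the length of the list of the lower
    coefficients. *)
Definition monic_of (n : nat) (s : seq {poly K}) : {poly {poly K}} := 'X ^+ n + Poly s.

Lemma monic_of_monic n s : (size s <= n)%N -> monic_of n s \is monic.
Proof.
move=> sn; rewrite monicE /monic_of lead_coefDl ?lead_coefXn //.
by rewrite size_polyXn ltnS; apply: leq_trans (size_Poly s) sn.
Qed.

Lemma ev2_Poly (x z : K) s : ev2 x z (Poly s) = foldr (fun p r => r * x + p.[z]) 0 s.
Proof.
elim: s => [|p s IH]; first by rewrite /ev2 rmorph0 horner0.
by rewrite [Poly _]/= cons_poly_def ev2D ev2M ev2X ev2C IH.
Qed.

Lemma ev2_monic_of (x z : K) n s :
  ev2 x z (monic_of n s) = x ^+ n + foldr (fun p r => r * x + p.[z]) 0 s.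
Proof. by rewrite /monic_of ev2D ev2Xn ev2X ev2_Poly. Qed.

Let horner_rules :=
  (@hornerD K, @hornerN K, @hornerZ K, @hornerXn K, @hornerX K, @hornerC K).

(** In Tate form, the triples outside the chart are those with p = t and p = 0. Both
    are limits of triples on the same curve. *)
Lemma in_chart_dense : dense_open (X := Xi1_5_open K) (@in_chart K).
Proof.
split; first exact: zopen_chart.
move=> O zO [T OT]; have [Op Os On] := zO; have iT := Op _ OT.
have iN := tate_normal_triple two0 iT.
have ON : O (tate_normal T) by apply: Os OT iN (tate_normal_iso two0 iT).
set b := tate_b T.
have NE : tate_normal T = tate_at b (vec_of (omap (tate_pt T) (point_of (tpoint T)))) by [].
move: (omap _ _) NE ON iN => P -> ON iN {OT iT}.
have /is_triple_tate[d0 oP] := iN; have b0 := wdisc_tcrv_neq0 d0.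
have : P = None \/ P = Some (0, 0) \/ exists2 Q, P = Some Q & Q != (0, 0).
  case: (P) => [Q|]; last by left.
  by right; have [->|Q0] := eqVneq Q (0, 0); [left | right; exists Q].
case=> [PE|[PE|[Q PE Q0]]]; last first.
- exists (tate_at b (vec_of P)) => //; rewrite PE in iN *; apply: tate_at_in_chart => //.
    by have [_ _ ->] := vec_of_affE Q; exact: oner_neq0.
  by rewrite vec_ofK.
(* Near t, the equation is monic in y, and x is the other coordinate. *)
- pose f := monic_of 2 [:: b *: 'X ^+ 2 - 'X ^+ 3; (1 - b) *: 'X - b%:P].
  pose w : 'rV[{poly {poly K}}]_3 := \row_i [:: 'X%:P; 'X; 1]`_i.
  have vE x z : map_mx (ev2 x z) w = vec_of (Some (z, x)).
    by apply/rowP => i; rewrite /vec_of !mxE; case: i => [[|[|[|]]] ?] //=;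
      rewrite ?ev2_1 ?ev2X ?ev2C ?hornerX.
  have fm : f \is monic by exact: monic_of_monic.
  have f0 : ev2 0 0 f = 0 by rewrite /f ev2_monic_of /= !horner_rules; ring.
  have [|x [z [z0 fz OT]]] :=
    tate_at_dense (b := b) (w := w) (x0 := 0) (z0 := 0) zO _ fm f0 (negbT (polyX_eq0 K)).
    by rewrite vE -PE.
  rewrite hornerX vE in z0 OT.
  have iT : is_triple (tate_at b (vec_of (Some (z, x)))).
    apply/is_triple_tate; split=> //; apply/on_curve_vec_of/on_tateE.
    rewrite /on_tate /=; move: fz; rewrite /f ev2_monic_of /= !horner_rules => fz.
    by apply/eqP; rewrite -subr_eq0 -fz; apply/eqP; ring.
  exists (tate_at b (vec_of (Some (z, x)))); first exact: OT.
  apply: tate_at_in_chart => //; first by have [_ _ ->] := vec_of_affE (z, x); exact: oner_neq0.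
  by rewrite vec_ofK; apply: contraNneq z0 => -[->].
(* Near the flex (0 : 1 : 0), in the chart y = 1, the equation is monic in x. *)
- pose f := monic_of 3 [:: b *: 'X ^+ 2 - 'X; (b - 1) *: 'X; - b *: 'X].
  pose w : 'rV[{poly {poly K}}]_3 := \row_i [:: 'X; 1; 'X%:P]`_i.
  pose v x z : 'rV[K]_3 := \row_i [:: x; 1; z]`_i.
  have vE x z : map_mx (ev2 x z) w = v x z.
    by apply/rowP => i; rewrite !mxE; case: i => [[|[|[|]]] ?] //=;
      rewrite ?ev2_1 ?ev2X ?ev2C ?hornerX.
  have fm : f \is monic by exact: monic_of_monic.
  have f0 : ev2 0 0 f = 0 by rewrite /f ev2_monic_of /= !horner_rules; ring.
  have [|x [z [z0 fz OT]]] :=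
    tate_at_dense (b := b) (w := w) (x0 := 0) (z0 := 0) zO _ fm f0 (negbT (polyX_eq0 K)).
    by rewrite vE; move: ON; rewrite PE.
  rewrite hornerX vE in z0 OT.
  have iT : is_triple (tate_at b (v x z)).
    apply/is_triple_tate; split=> //; split.
      apply: contraNneq z0 => v0; have := congr1 (fun u : 'rV[K]_3 => u 0 (inord 2)) v0.
      by rewrite /v row3E // mxE /= => ->.
    rewrite /v !row3E //= /weq /=; move: fz; rewrite /f ev2_monic_of /= !horner_rules => fz.
    by apply: oppr_inj; rewrite oppr0 -[RHS]fz; ring.
  have vz : v x z 0 (inord 2) = z by rewrite /v row3E.
  exists (tate_at b (v x z)); first exact: OT.
  apply: tate_at_in_chart; rewrite ?vz //.
  rewrite /point_of vz (negPf z0) /v !row3E //=.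
  apply: contraNneq (oner_neq0 K) => -[_ /eqP].
  by rewrite mulf_eq0 invr_eq0 (negPf z0) orbF.
Qed.

End ChartDense.

(** * Generic triples *)

Lemma pchar0_natr_neq0 (K : fieldType) : [pchar K] =i pred0 -> forall n, n.+1%:R != 0 :> K.
Proof. by move=> /pcharf0P c0 n; rewrite c0. Qed.

Section GenericTriples.
Variable K : closedFieldType.
Hypothesis charK0 : [pchar K] =i pred0.
Let nz := pchar0_natr_neq0 charK0.

Lemma birational_Xi1_5_plane : birational (Xi1_5_open K) (plane K).
Proof.
have two0 := nz 1.
exists (@in_chart K), (@tate_plane K); split; first exact: in_chart_dense.
  apply: (@plane_dense _ _ (plane_vec (3, 3))); first exact: zopen_tate_plane.
  rewrite /tate_plane plane_vecK wdisc_tcrv /tate_param /tate_q /tate_n /=.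
  have q : 3 ^+ 2 - 3 * 3 - 3 = - 3%:R :> K by ring.
  have b : (3 ^+ 3 - 3 ^+ 2 - 3 * 3) / (- 3%:R) = - 3%:R :> K by field; rewrite oppr_eq0; exact: nz.
  rewrite q b; split; first by rewrite oppr_eq0 nz.
  rewrite mulf_neq0 ?expf_neq0 ?oppr_eq0 ?nz //.
  by rewrite (_ : _ - 1 = 41%:R) ?nz //; ring.
exists (@chart_of_triple K), (@triple_of_chart K); split.
- exact: chart_of_triple_morphism.
- exact: triple_of_chart_morphism.
- move=> T cT; have [_ sym _] := triple_iso_equivalence K.
  exact/sym/triple_of_chart_iso.
- move=> e Ve; rewrite /= /chart_of_triple triple_of_chartK //; exact: plane_ptK.
Qed.

(** The parameters for which p is not a multiple of t. *)
Definition off_plane (e : 'rV[K]_2) : Prop :=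
  let P := plane_pt e in
  (tate_plane e /\ P.1 != 0) /\ P.1 - tate_param P != 0.

Lemma off_planeP e : off_plane e ->
  tate_param (plane_pt e) != 0 /\ off_torsion (tate_param (plane_pt e)) (plane_pt e).
Proof.
case=> [[[q0 d0] x0] xb]; split; first exact: wdisc_tcrv_neq0.
by split=> //; [apply/on_tate_param | rewrite -subr_eq0].
Qed.

Lemma zopen_off_plane : zopen (X := plane K) off_plane.
Proof.
have [rx ry] := lregular_plane (@tate_plane K).
have z1 := @zopen_neq0 _ (plane K) _ _ (zopen_tate_plane K) rx.
apply: (@zopen_neq0 _ (plane K) _ (fun e => (plane_pt e).1 - tate_param (plane_pt e)) (z1 _)).
- by move=> e e' _ _ ->.
- set U := fun e => _; have [rx' ry'] := lregular_plane U.
  have rb : lregular U (fun e => tate_param (plane_pt e)).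
    by apply: lregular_tate_param => e [[]].
  by lreg.
- by move=> e e' _ _ ->.
Qed.

Let orbit (e : 'rV[K]_2) m := tau_pt (tate_param (plane_pt e)) (plane_pt e) m.

Lemma lregular_orbit (U : car (plane K) -> Prop) m : (forall e, U e -> off_plane e) ->
  lregular U (fun e => (orbit e m).1) /\ lregular U (fun e => (orbit e m).2).
Proof.
move=> Uoff; have [rx ry] := lregular_plane U.
have rb : lregular U (fun e => tate_param (plane_pt e)).
  by apply: lregular_tate_param => e /Uoff[[[]]].
elim: m => [|m [IH1 IH2]] //.
have rV k : lregular U (fun e => ((orbit e m).1 ^+ k)^-1).
  apply: lregularV => [e /Uoff/off_planeP[b0 NP]|]; last exact: lregularX.
  by have [_ x0 _] := off_torsion_iter b0 m NP; rewrite expf_neq0.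
have [r2 r3] := (rV 2%N, rV 3%N).
split.
  apply: (@lregular_ext _ (plane K) U
    (fun e => tate_param (plane_pt e) * (orbit e m).2 / (orbit e m).1 ^+ 2)) => //.
  by lreg.
apply: (@lregular_ext _ (plane K) U
  (fun e => tate_param (plane_pt e) ^+ 2 * ((orbit e m).1 ^+ 2 - (orbit e m).2)
    / (orbit e m).1 ^+ 3)) => //.
by lreg.
Qed.

Definition generic_den (e : 'rV[K]_2) : K := \prod_(m < 5) dbl_den (tate_param (plane_pt e)) (orbit e m).

Definition generic_num (e : 'rV[K]_2) : K :=
  let b := tate_param (plane_pt e) in
  let x := (neg_dbl b (plane_pt e)).1 in
  x * (x - b) * \prod_(m < 5) pent_den b (plane_pt e) m.

Definition generic_plane (e : 'rV[K]_2) : Prop :=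
  (off_plane e /\ generic_den e != 0) /\ generic_num e != 0.

Lemma zopen_generic_plane : zopen (X := plane K) generic_plane.
Proof.
have rb (U : car (plane K) -> Prop) : (forall e, U e -> off_plane e) ->
    lregular U (fun e => tate_param (plane_pt e)).
  by move=> Uoff; apply: lregular_tate_param => e /Uoff[[[]]].
have z1 : zopen (X := plane K) (fun e => off_plane e /\ generic_den e != 0).
  apply: (@zopen_neq0 _ (plane K) _ generic_den zopen_off_plane).
    apply: lregular_prod => m; have rb1 := rb off_plane (fun _ h => h).
    have [r1 r2] := @lregular_orbit off_plane m (fun _ h => h).
    by rewrite /dbl_den; lreg.
  by move=> e e' _ _ ->.
apply: (@zopen_neq0 _ (plane K) _ generic_num z1); last by move=> e e' _ _ ->.
set U := fun e => _; have Uoff e : U e -> off_plane e by case.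
have rbU := rb U Uoff.
have [r0 r1] := lregular_plane U.
have rD : lregular U (fun e => (dbl_den (tate_param (plane_pt e)) (plane_pt e))^-1).
  apply: lregularV => [e [_]|]; last by rewrite /dbl_den; lreg.
  by rewrite /generic_den big_ord_recl mulf_eq0 negb_or => /andP[].
rewrite /generic_num; apply: lregularM; first by rewrite /neg_dbl /=; lreg.
apply: lregular_prod => m; rewrite /pent_den /meet_den /=.
have [p1 q1] := @lregular_orbit U (m + 1) Uoff; have [p2 q2] := @lregular_orbit U (m + 2) Uoff.
have [p3 q3] := @lregular_orbit U (m + 3) Uoff; have [p4 q4] := @lregular_orbit U (m + 4) Uoff.
by rewrite /orbit in p1 q1 p2 q2 p3 q3 p4 q4; lreg.
Qed.

Lemma generic_plane_point e : generic_plane e ->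
  tate_param (plane_pt e) != 0 /\ generic_point (tate_param (plane_pt e)) (plane_pt e).
Proof.
move=> [[oe den0] num0]; have [b0 NP] := off_planeP oe; split=> //.
set b := tate_param _ in b0 NP *; set P := plane_pt e in b b0 NP *.
have mod5 m : tau_pt b P m = tau_pt b P (m %% 5).
  rewrite {1}(divn_eq m 5); elim: (m %/ 5)%N => // k IH.
  by rewrite mulSn -addnA addnC tau_pt5.
have D0 m : dbl_den b (tau_pt b P m) != 0.
  rewrite mod5; have m5 : (m %% 5 < 5)%N by rewrite ltn_mod.
  by move/prodf_neq0: den0 => /(_ (Ordinal m5) isT).
move: num0; rewrite /generic_num !mulf_eq0 !negb_or -/P -/b => /andP[/andP[X0 Xb] S0].
split=> //.
  split=> //; last by rewrite -subr_eq0.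
  exact: neg_dbl_on_tate (D0 0%N).
move=> m; have m5 : (m %% 5 < 5)%N by rewrite ltn_mod.
move/prodf_neq0: S0 => /(_ (Ordinal m5) isT); rewrite /pent_den /=.
have sh k : tau_pt b P (m %% 5 + k) = tau_pt b P (m + k).
  by rewrite mod5 [RHS]mod5 modnDml.
by rewrite !sh.
Qed.

(** On the Tate curve of parameter -3, which has discriminant - 3 ^ 5 * 41, the
    point (3, 3) is generic: all the relevant quantities are products of powers
    of 2, 3, 5 and 7. *)
Lemma generic_plane_inhabited : generic_plane (plane_vec (3, 3)).
Proof.
have [n2 n3] : 2%:R != 0 :> K /\ 3%:R != 0 :> K.
  by rewrite !nz.
have n41 : 41%:R != 0 :> K by rewrite nz.
have q : tate_q (3, 3) = - 3%:R :> K by rewrite /tate_q /=; ring.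
have bE : tate_param (3, 3) = - 3%:R :> K.
  rewrite /tate_param q /tate_n /=; field; by rewrite oppr_eq0.
have t1 : tau (- 3%:R) (3, 3) = (- 1, 2%:R) :> K * K.
  by congr (_, _) => /=; field; rewrite ?oppr_eq0 ?oner_neq0 ?nz.
have t2 : tau (- 3%:R) (- 1, 2%:R) = (- 6%:R, 9%:R) :> K * K.
  by congr (_, _) => /=; field; rewrite ?oppr_eq0 ?oner_neq0 ?nz.
have n6 : 6%:R != 0 :> K by rewrite nz.
have t3 : tau (- 3%:R) (- 6%:R, 9%:R) = (- 3%:R / 4%:R, - 9%:R / 8%:R) :> K * K.
  by congr (_, _) => /=; field; rewrite ?oppr_eq0 ?oner_neq0 ?nz.
have t4 : tau (- 3%:R) (- 3%:R / 4%:R, - 9%:R / 8%:R) = (6%:R, - 36%:R) :> K * K.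
  by congr (_, _) => /=; field; rewrite ?oppr_eq0 ?oner_neq0 ?nz.
have t5 : tau (- 3%:R) (6%:R, - 36%:R) = (3, 3) :> K * K.
  by congr (_, _) => /=; field; rewrite ?oppr_eq0 ?oner_neq0 ?nz.
set b : K := - 3%:R in t1 t2 t3 t4 t5 bE *.
have o1 : tau_pt b (3, 3) 1 = _ := t1.
have o2 : tau_pt b (3, 3) 2 = _ := etrans (congr1 (tau b) o1) t2.
have o3 : tau_pt b (3, 3) 3 = _ := etrans (congr1 (tau b) o2) t3.
have o4 : tau_pt b (3, 3) 4 = _ := etrans (congr1 (tau b) o3) t4.
have o5 : tau_pt b (3, 3) 5 = _ := etrans (congr1 (tau b) o4) t5.
have o6 : tau_pt b (3, 3) 6 = _ := etrans (congr1 (tau b) o5) t1.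
have o7 : tau_pt b (3, 3) 7 = _ := etrans (congr1 (tau b) o6) t2.
have o8 : tau_pt b (3, 3) 8 = _ := etrans (congr1 (tau b) o7) t3.
have pE (A B C D A' B' C' D' : K * K) : A = A' -> B = B' -> C = C' -> D = D' ->
    meet_den A B C D = meet_den A' B' C' D' by move=> -> -> -> ->.
have D0 : dbl_den b (3, 3) = 21%:R by rewrite /dbl_den /= /b; ring.
rewrite /generic_plane /off_plane /tate_plane /orbit plane_vecK bE q.
do !split.
- by rewrite oppr_eq0.
- rewrite wdisc_tcrv mulf_neq0 ?expf_neq0 ?oppr_eq0 //.
  by rewrite (_ : _ - 1 = 41%:R) // /b; ring.
- by [].
- by rewrite (_ : _ - b = 6%:R) // /b /=; ring.
- apply/prodf_neq0 => m _; rewrite /orbit plane_vecK bE.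
  case: m => [[|[|[|[|[|]]]]] ?] //; rewrite [nat_of_ord _]/=.
  + by rewrite D0 nz.
  + by rewrite o1 (_ : dbl_den _ _ = 3%:R) // /dbl_den /b /=; ring.
  + by rewrite o2 (_ : dbl_den _ _ = - 3%:R) ?oppr_eq0 // /dbl_den /b /=; ring.
  + rewrite o3 (_ : dbl_den _ _ = - 9%:R / 4%:R) ?mulf_neq0 ?invr_neq0 ?oppr_eq0 ?nz //.
    by rewrite /dbl_den /b /=; field; rewrite !nz.
  + by rewrite o4 (_ : dbl_den _ _ = - 45%:R) ?oppr_eq0 ?nz // /dbl_den /b /=; ring.
rewrite /generic_num plane_vecK bE.
have X0 : (neg_dbl b (3, 3)).1 = - 12%:R / 49%:R.
  by rewrite /neg_dbl D0 /b /=; field; rewrite !nz.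
rewrite X0 mulf_neq0 //; first rewrite mulf_neq0 //.
- by rewrite mulf_neq0 ?invr_neq0 ?oppr_eq0 ?nz.
- rewrite (_ : _ - b = 135%:R / 49%:R) ?mulf_neq0 ?invr_neq0 ?nz //.
  by rewrite /b; field; rewrite nz.
apply/prodf_neq0 => m _; case: m => [[|[|[|[|[|]]]]] ?] //; rewrite [nat_of_ord _]/=.
- have -> : pent_den b (3, 3) 0 = meet_den _ _ _ _ := pE _ _ _ _ _ _ _ _ o1 o4 o2 o3.
  rewrite (_ : meet_den _ _ _ _ = 1029%:R / 8%:R) ?mulf_neq0 ?invr_neq0 ?nz //.
  by rewrite /meet_den /b /=; field; rewrite !nz.
- have -> : pent_den b (3, 3) 1 = meet_den _ _ _ _ := pE _ _ _ _ _ _ _ _ o2 o5 o3 o4.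
  rewrite (_ : meet_den _ _ _ _ = - 2187%:R / 8%:R) ?mulf_neq0 ?invr_neq0 ?oppr_eq0 ?nz //.
  by rewrite /meet_den /b /=; field; rewrite !nz.
- have -> : pent_den b (3, 3) 2 = meet_den _ _ _ _ := pE _ _ _ _ _ _ _ _ o3 o6 o4 o5.
  rewrite (_ : meet_den _ _ _ _ = - 3%:R / 8%:R) ?mulf_neq0 ?invr_neq0 ?oppr_eq0 ?nz //.
  by rewrite /meet_den /b /=; field; rewrite !nz.
- have -> : pent_den b (3, 3) 3 = meet_den _ _ _ _ := pE _ _ _ _ _ _ _ _ o4 o7 o5 o6.
  rewrite (_ : meet_den _ _ _ _ = 192%:R) ?nz //.
  by rewrite /meet_den /b /=; ring.
- have -> : pent_den b (3, 3) 4 = meet_den _ _ _ _ := pE _ _ _ _ _ _ _ _ o5 o8 o6 o7.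
  rewrite (_ : meet_den _ _ _ _ = - 375%:R / 8%:R) ?mulf_neq0 ?invr_neq0 ?oppr_eq0 ?nz //.
  by rewrite /meet_den /b /=; field; rewrite !nz.
Qed.

Lemma Psi_mulN2 : exists2 U : car (Xi1_5_open K) -> Prop, dense_open U &
  forall T : triple K, U T ->
    arr_equiv (Psi (triple_points T)) (triple_points (triple_mulN2 T)).
Proof.
have two0 := nz 1.
have dG : dense_open (X := plane K) generic_plane.
  by apply: plane_dense generic_plane_inhabited; exact: zopen_generic_plane.
exists (fun T => in_chart T /\ (tate_plane (chart_of_triple T) /\ generic_plane (chart_of_triple T))).
  have [_ sym _] := triple_iso_equivalence K.
  apply: (@dense_open_preimage _ (Xi1_5_open K) (plane K) _ _ _ _ (@triple_of_chart K)).
  - exact: triple_iso_equivalence.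
  - exact: in_chart_dense.
  - exact: zopen_tate_plane.
  - exact: chart_of_triple_morphism.
  - exact: triple_of_chart_morphism.
  - by move=> T cT; exact/sym/triple_of_chart_iso.
  - by move=> e Ve; rewrite /= /chart_of_triple triple_of_chartK //; exact: plane_ptK.
  - exact: dG.
move=> T [cT [Ve Ge]]; have [b0 gP] := generic_plane_point Ge.
have [_ symA trA] := arr_equiv_equivalence K 'Z_5.
have [[_ op ot _ _] _] := triple_of_chart_affine Ve.
have [e1 e2] := triple_points_iso two0 op ot (triple_of_chart_iso two0 cT).
apply: (trA _ _ _ _ e2); apply: (trA _ _ _ _ (Psi_tate b0 gP)).
exact/Psi_equiv/symA.
Qed.

End GenericTriples.

(** * Realizations are determined by five lines *)

Definition nonbasis3 (a b c : label) : bool :=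
  match a, b, c with
  | inl i, inl j, inr r | inl i, inr r, inl j | inr r, inl i, inl j => i + j + r == 0
  | _, _, _ => false
  end.

Lemma M5_nonbasisE (a b c : label) : a != b -> b != c -> a != c ->
  M5_nonbasis [set a; b; c] = nonbasis3 a b c.
Proof.
move=> ab bc ac; apply/idP/idP; last first.
  have key (i j r : 'Z_5) (S : {set label}) : i != j -> i + j + r == 0 ->
      S = [set inl i; inl j; inr r] -> M5_nonbasis S.
    move=> ij s ->; apply/existsP; exists i; apply/existsP; exists j; apply/existsP; exists r.
    by rewrite ij s eqxx.
  case: a b c ab bc ac => [i|i] [j|j] [k|k] //= ab bc ac s.
  - exact: (key i j k).
  - by apply: (key i k j) => //; rewrite setUAC.
  - by apply: (key j k i) => //; rewrite -setUA setUC.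
case/existsP=> i /existsP[j /existsP[r /and3P[ij s /eqP E]]].
have mem x : (x \in [set a; b; c]) = (x \in [set inl i; inl j; inr r]) by rewrite E.
have [ma mb mc] : [/\ a \in [set inl i; inl j; inr r], b \in [set inl i; inl j; inr r] &
                       c \in [set inl i; inl j; inr r]].
  by rewrite -!mem !inE !eqxx !orbT.
have mr : inr r \in [set a; b; c] by rewrite mem !inE eqxx !orbT.
have inlE (x y : 'Z_5) : (inl x == inl y :> label) = (x == y) by [].
have inrE (x y : 'Z_5) : (inr x == inr y :> label) = (x == y) by [].
have lr (x y : 'Z_5) : (inl x == inr y :> label) = false by [].
have rl (x y : 'Z_5) : (inr x == inl y :> label) = false by [].
case: a b c ab bc ac ma mb mc mr {mem E} => [a|a] [b|b] [c|c] //=;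
  rewrite !inE ?inlE ?inrE ?lr ?rl ?orbF ?orFb //.
- move=> ab _ _ /orP[]/eqP ea /orP[]/eqP eb /eqP ec _; rewrite ea eb ec in ab *;
  by first [rewrite eqxx in ab | exact: s | rewrite [j + i]addrC].
- move=> _ _ ac /orP[]/eqP ea /eqP eb /orP[]/eqP ec _; rewrite ea eb ec in ac *;
  by first [rewrite eqxx in ac | exact: s | rewrite [j + i]addrC].
- by move=> _ bc _ _ /eqP eb /eqP ec; rewrite eb ec eqxx in bc.
- move=> _ bc _ /eqP ea /orP[]/eqP eb /orP[]/eqP ec _; rewrite ea eb ec in bc *;
  by first [rewrite eqxx in bc | exact: s | rewrite [j + i]addrC].
- by move=> _ _ ac /eqP ea _ /eqP ec; rewrite ea ec eqxx in ac.
- by move=> ab _ _ /eqP ea /eqP eb; rewrite ea eb eqxx in ab.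
- by move=> ab _ _ /eqP ea /eqP eb; rewrite ea eb eqxx in ab.
Qed.

(** Hence the lines of a configuration are pairwise distinct as soon as its bases are
    not concurrent. *)
Lemma basis_completion (a b : label) : a != b ->
  exists c : label, [/\ b != c, a != c & ~~ nonbasis3 a b c].
Proof.
have one0 : (1 : 'Z_5) != 0 by [].
case: a b => [i|r] [j|s] //= ab.
- exists (inr (1 - (i + j))); split=> //=.
  by rewrite addrC subrK.
- exists (inr (s + 1)); split=> //=.
  by rewrite -[inr s == _]/(s == s + 1) -{1}[s]addr0 (inj_eq (addrI s)) eq_sym.
- exists (inr (r + 1)); split=> //=.
  by rewrite -[inr r == _]/(r == r + 1) -{1}[r]addr0 (inj_eq (addrI r)) eq_sym.
- by exists (inl 0).
Qed.

Section Realizations.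
Variable K : fieldType.
Implicit Types (L : label -> 'rV[K]_3) (N : pentagon K).

Lemma br_neq0_cross (u v w : 'rV[K]_3) : br u v w != 0 -> cross u v != 0.
Proof.
apply: contraNneq => uv; rewrite br_cross uv.
by rewrite big1 // => i _; rewrite mxE mul0r.
Qed.

Lemma realization_br L : realization L <->
  forall a b c, a != b -> b != c -> a != c ->
    (br (L a) (L b) (L c) == 0) = nonbasis3 a b c.
Proof.
split=> [[L1 L2] a b c ab bc ac|H].
  have := L2 a b c ab bc ac; rewrite M5_nonbasisE // => h.
  by apply/eqP/idP => [/(concurrent_br _ (L1 _ _ ab))/h|/h/(concurrent_br _ (L1 _ _ ab))].
have L1 a b : a != b -> cross (L a) (L b) != 0.
  move=> ab; have [c [bc ac nb]] := basis_completion ab.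
  by apply: (@br_neq0_cross _ _ (L c)); rewrite H.
split=> // a b c ab bc ac; rewrite M5_nonbasisE // -H //.
by split=> [/(concurrent_br _ (L1 _ _ ab))->|/eqP/(concurrent_br _ (L1 _ _ ab))].
Qed.

Lemma realization_equiv L L' : arr_equiv L L' -> realization L -> realization L'.
Proof.
case=> g ug LL' /realization_br H; apply/realization_br => a b c ab bc ac.
have [k k0 ->] := LL' a; have [l l0 ->] := LL' b; have [m m0 ->] := LL' c.
rewrite brZZZ br_mulmx -H // !mulf_eq0 (negPf k0) (negPf l0) (negPf m0).
by rewrite (negPf (mxbr_unit ug)) /= orbF.
Qed.

(** The remaining five lines of a realization are determined by the first five:
    the labels i, j with i + j + r = 0 form two disjoint pairs. *)
Definition of_pentagon N : label -> 'rV[K]_3 := fun a =>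
  match a with
  | inl i => N i
  | inr r => let m := 2 * r in
      cross (cross (N (m + 1)) (N (m - 1))) (cross (N (m + 2)) (N (m - 2)))
  end.

Lemma of_pentagon_equiv N N' : arr_equiv N N' -> arr_equiv (of_pentagon N) (of_pentagon N').
Proof.
case=> g ug NN'; exists g => // -[i|r] /=; first exact: NN'.
have [a a0 ->] := NN' (2 * r + 1); have [b b0 ->] := NN' (2 * r - 1).
have [c c0 ->] := NN' (2 * r + 2); have [d d0 ->] := NN' (2 * r - 2).
exists (a * b * (c * d) * mxbr g); first by rewrite !mulf_neq0 ?mxbr_unit.
by rewrite !crossZ cross_cross_mulmx scalerA.
Qed.

Lemma parallel (u v : 'rV[K]_3) : cross u v = 0 -> u != 0 -> v != 0 ->
  exists2 c : K, c != 0 & v = c *: u.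
Proof.
move=> uv u0 v0; have [e0 e1 e2] := crossE u v.
rewrite uv !mxE in e0 e1 e2.
have [k uk] : exists k, u 0 k != 0.
  by apply/rV0Pn.
have ve : v = (v 0 k / u 0 k) *: u.
  apply/rowP => l; rewrite mxE; apply: (mulIf uk); rewrite mulrAC divfK //.
  have i3 (i : 'I_3) : i = inord 0 \/ i = inord 1 \/ i = inord 2.
    by case: i => [[|[|[|]]] ?] //; [left|right; left|right; right];
       apply/val_inj; rewrite /= inordK.
  have s0 x y : 0 = x - y -> x = y :> K by move/esym/eqP; rewrite subr_eq0 => /eqP.
  move/s0 in e0; move/s0 in e1; move/s0 in e2.
  have [el|[el|el]] := i3 l; have [ek|[ek|ek]] := i3 k; rewrite el ek;
    by first [ring | ring: e0 | ring: e1 | ring: e2].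
exists (v 0 k / u 0 k) => //; apply: contraNneq v0 => c0.
by rewrite ve c0 scale0r.
Qed.

(** The line r passes through the two double points, which are different as no three
    of the first five lines are concurrent. *)
Lemma realization_of_pentagon L : realization L ->
  arr_equiv L (of_pentagon (fun i => L (inl i))).
Proof.
move=> rL; exists 1%:M => [|[i|r]]; first exact: unitmx1.
  by exists 1; rewrite ?oner_eq0 // mulmx1 scale1r.
rewrite mulmx1 /=; set m := 2 * r; have [L1 _] := rL; move/realization_br: rL => H.
have ne (d d' : 'Z_5) : d != d' -> inl (m + d) != inl (m + d') :> label.
  by move=> dd'; rewrite -[_ == _]/(m + d == m + d') (inj_eq (addrI m)).
have z5 : 5%:R = 0 :> 'Z_5 by exact: val_inj.
have on1 : br (L (inl (m + 1))) (L (inl (m - 1))) (L (inr r)) = 0.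
  have e : m + 1 + (m - 1) + r = 0.
    by transitivity (5%:R * r); [rewrite /m; ring | rewrite z5 mul0r].
  by apply/eqP; rewrite H ?ne //= e.
have on2 : br (L (inl (m + 2))) (L (inl (m - 2))) (L (inr r)) = 0.
  have e : m + 2 + (m - 2) + r = 0.
    by transitivity (5%:R * r); [rewrite /m; ring | rewrite z5 mul0r].
  by apply/eqP; rewrite H ?ne //= e.
set w := L (inr r) in on1 on2 *.
set a := L (inl (m + 1)) in on1 *; set b := L (inl (m - 1)) in on1 *.
set c := L (inl (m + 2)) in on2 *; set d := L (inl (m - 2)) in on2 *.
apply: parallel.
- by rewrite cross_crossr -!br_cross on1 on2 !scale0r subr0.
- have := L1 (inr r) (inl 0) isT; rewrite -/w; apply: contraNneq => ->.
  by rewrite cross0.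
rewrite cross_cross; have abd : br a b d != 0 by rewrite H // ne.
have cd : cross c d != 0 by apply: L1; apply: ne.
apply: contraNneq cd => /eqP; rewrite subr_eq0 => /eqP E.
have [k ->] : exists k, c = k *: d.
  by exists (br a b c / br a b d); rewrite mulrC -scalerA -E scalerA mulVf ?scale1r.
by rewrite -[X in cross _ X]scale1r crossZ cross_same scaler0.
Qed.

End Realizations.

(** * The chart of the realization space *)

Section Chart.
Variable K : fieldType.
Implicit Types (L : label -> 'rV[K]_3) (N : pentagon K).

Notation x0 v := (v 0 (inord 0)).
Notation x1 v := (v 0 (inord 1)).
Notation x2 v := (v 0 (inord 2)).

Definition vec3 (a b c : K) : 'rV[K]_3 := \row_i [:: a; b; c]`_i.

Lemma vec3E a b c : [/\ x0 (vec3 a b c) = a, x1 (vec3 a b c) = b & x2 (vec3 a b c) = c].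
Proof. by rewrite /vec3 !row3E. Qed.

Lemma cramer (a b c d : 'rV[K]_3) : br a b c *: d = br d b c *: a + br a d c *: b + br a b d *: c.
Proof. by apply: row3P; rewrite /br !mxE; ring. Qed.

(** The columns of the adjugate matrix are cross products of rows. *)
Lemma mxbr_neq0_unit (g : 'M[K]_3) : mxbr g != 0 -> g \in unitmx.
Proof.
move=> g0; pose r k := row (inord k) g.
pose h : 'M[K]_3 := \matrix_(i, j)
  ([:: cross (r 1%N) (r 2%N); cross (r 2%N) (r 0%N); cross (r 0%N) (r 1%N)]`_j 0 i).
have /mulmx1_unit[] // : g *m ((mxbr g)^-1 *: h) = 1%:M.
rewrite -scalemxAr; suff -> : g *m h = (mxbr g)%:M by rewrite scale_scalar_mx mulVf.
have br_same2 (u v : 'rV[K]_3) : br u v u = 0 by rewrite /br; ring.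
have br_same3 (u v : 'rV[K]_3) : br v u u = 0 by rewrite /br; ring.
have E i (u v : 'rV[K]_3) : \sum_k row i g 0 k * cross u v 0 k = br u v (row i g).
  by rewrite br_cross; apply: eq_bigr => k _; rewrite mulrC.
have gh i j : (g *m h) i j = br
    [:: r 1%N; r 2%N; r 0%N]`_j [:: r 2%N; r 0%N; r 1%N]`_j (row i g).
  rewrite -E mxE; apply: eq_bigr => k _; congr (_ * _); first by rewrite mxE.
  by rewrite mxE; case: j => [[|[|[|]]] ?].
have i3 (i : 'I_3) : row i g = r i by rewrite /r inord_val.
apply/matrixP => i j; rewrite gh mxE i3 -val_eqE.
case: i => [[|[|[|]]] ?] //; case: j => [[|[|[|]]] ?] //=;
  rewrite ?br_same2 ?br_same3 ?mulr0n ?mulr1n // /mxbr -/(r 0%N) -/(r 1%N) -/(r 2%N).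
- by rewrite br_rot br_rot.
- by rewrite br_rot.
Qed.

Definition normal_pentagon (P : K * K) : pentagon K := fun i =>
  [:: vec3 1 0 0; vec3 0 1 0; vec3 0 0 1; vec3 1 1 1; vec3 P.1 P.2 1]`_(i : 'I_5).

(** The coordinates of the line 4 in the frame of the lines 0, 1, 2 with unit line 3. *)
Definition pent_xy N : K * K :=
  ((br (N 4) (N 1) (N 2) * br (N 0) (N 1) (N 3)) / (br (N 3) (N 1) (N 2) * br (N 0) (N 1) (N 4)),
   (br (N 0) (N 4) (N 2) * br (N 0) (N 1) (N 3)) / (br (N 0) (N 3) (N 2) * br (N 0) (N 1) (N 4))).

Definition general_position N := forall i j k : 'Z_5, i != j -> j != k -> i != k ->
  br (N i) (N j) (N k) != 0.

Lemma br_vec3 a b c a' b' c' a'' b'' c'' :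
  br (vec3 a b c) (vec3 a' b' c') (vec3 a'' b'' c'') =
  a * (b' * c'' - c' * b'') + b * (c' * a'' - a' * c'') + c * (a' * b'' - b' * a'').
Proof.
by rewrite /br; have [-> -> ->] := vec3E a b c; have [-> -> ->] := vec3E a' b' c';
  have [-> -> ->] := vec3E a'' b'' c''.
Qed.

Lemma pent_xy_normal P : pent_xy (normal_pentagon P) = P.
Proof.
case: P => u v; rewrite /pent_xy /normal_pentagon /= !br_vec3; congr (_, _); field; exact: oner_neq0.
Qed.

Lemma pent_xy_equiv N N' : general_position N -> arr_equiv N N' -> pent_xy N' = pent_xy N.
Proof.
move=> gN [g ug NN']; have m0 := mxbr_unit ug.
have [c0 c00 e0] := NN' 0; have [c1 c10 e1] := NN' 1; have [c2 c20 e2] := NN' 2.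
have [c3 c30 e3] := NN' 3; have [c4 c40 e4] := NN' 4.
rewrite /pent_xy e0 e1 e2 e3 e4 !brZZZ !br_mulmx.
have n1 : br (N 3) (N 1) (N 2) != 0 by apply: gN.
have n2 : br (N 0) (N 1) (N 4) != 0 by apply: gN.
have n3 : br (N 0) (N 3) (N 2) != 0 by apply: gN.
by congr (_, _); field; rewrite ?c00 ?c10 ?c20 ?c30 ?c40 ?m0 ?n1 ?n2 ?n3.
Qed.

Lemma normal_pentagon_equiv N : general_position N ->
  arr_equiv N (normal_pentagon (pent_xy N)).
Proof.
move=> gN; have [_ sym _] := arr_equiv_equivalence K 'Z_5; apply: sym.
have n312 : br (N 3) (N 1) (N 2) != 0 by apply: gN.
have n032 : br (N 0) (N 3) (N 2) != 0 by apply: gN.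
have n013 : br (N 0) (N 1) (N 3) != 0 by apply: gN.
have n014 : br (N 0) (N 1) (N 4) != 0 by apply: gN.
have n012 : br (N 0) (N 1) (N 2) != 0 by apply: gN.
(* By Cramer's rule N 3 is proportional to a0 + a1 + a2, the unit of the frame. *)
pose a0 := br (N 3) (N 1) (N 2) *: N 0; pose a1 := br (N 0) (N 3) (N 2) *: N 1.
pose a2 := br (N 0) (N 1) (N 3) *: N 2.
pose G : 'M[K]_3 := \matrix_(i, j) [:: a0; a1; a2]`_i 0 j.
have rG k : (k < 3)%N -> row (inord k) G = [:: a0; a1; a2]`_k.
  by move=> k3; apply/rowP => j; rewrite !mxE inordK.
have vG a b c : vec3 a b c *m G = a *: a0 + b *: a1 + c *: a2.
  apply/rowP => j; rewrite mulmx3E; have [-> -> ->] := vec3E a b c.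
  have GE k : (k < 3)%N -> G (inord k) j = [:: a0; a1; a2]`_k 0 j by move=> k3; rewrite mxE inordK.
  by rewrite !GE //= !mxE.
exists G.
  by apply: mxbr_neq0_unit; rewrite /mxbr !rG //= brZZZ !mulf_neq0.
have z5 (i : 'Z_5) : i = 0 \/ i = 1 \/ i = 2 \/ i = 3 \/ i = 4.
  case: i => [[|[|[|[|[|]]]]] i5] //; do ?[by left; exact: val_inj | right].
  exact: val_inj.
have NE P : [/\ normal_pentagon P 0 = vec3 1 0 0, normal_pentagon P 1 = vec3 0 1 0,
    normal_pentagon P 2 = vec3 0 0 1, normal_pentagon P 3 = vec3 1 1 1 &
    normal_pentagon P 4 = vec3 P.1 P.2 1] by [].
have [N0 N1 N2 N3 N4] := NE (pent_xy N).
move=> i; case: (z5 i) => [->|[->|[->|[->|->]]]]; rewrite ?N0 ?N1 ?N2 ?N3 ?N4 vG.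
- exists (br (N 3) (N 1) (N 2))^-1; first by rewrite invr_neq0.
  by rewrite !scale0r !addr0 scale1r scalerA mulVf ?scale1r.
- exists (br (N 0) (N 3) (N 2))^-1; first by rewrite invr_neq0.
  by rewrite !scale0r addr0 add0r scale1r scalerA mulVf ?scale1r.
- exists (br (N 0) (N 1) (N 3))^-1; first by rewrite invr_neq0.
  by rewrite !scale0r !add0r scale1r scalerA mulVf ?scale1r.
- exists (br (N 0) (N 1) (N 2))^-1; first by rewrite invr_neq0.
  by rewrite !scale1r -cramer scalerA mulVf ?scale1r.
pose c := br (N 0) (N 1) (N 3) / br (N 0) (N 1) (N 4).
exists (c * br (N 0) (N 1) (N 2))^-1; first by rewrite invr_neq0 // !mulf_neq0 ?invr_neq0.
have -> : (pent_xy N).1 *: a0 + (pent_xy N).2 *: a1 + 1 *: a2 =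
    (c * br (N 0) (N 1) (N 2)) *: N 4.
  rewrite -[RHS]scalerA cramer !scalerDr !scalerA.
  by congr (_ *: _ + _ *: _ + _ *: _); rewrite /pent_xy /c /=; field; rewrite ?n312 ?n014 ?n032.
by rewrite scalerA mulVf ?scale1r // !mulf_neq0 ?invr_neq0.
Qed.

Lemma realization_general_position L : realization L -> general_position (fun i => L (inl i)).
Proof. by move=> /realization_br H i j k ij jk ik; rewrite H. Qed.

Definition vregular X (U : car X -> Prop) (h : car X -> 'rV[K]_3) : Prop :=
  forall k, lregular U (fun x => h x 0 k).

Section Regular.
Variables (X : qspace K) (U : car X -> Prop).

Lemma lregular_br h h' h'' : vregular U h -> vregular U h' -> vregular U h'' ->
  lregular U (fun x => br (h x) (h' x) (h'' x)).
Proof.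
move=> rh rh' rh''.
have [a0 a1 a2] := And3 (rh (inord 0)) (rh (inord 1)) (rh (inord 2)).
have [b0 b1 b2] := And3 (rh' (inord 0)) (rh' (inord 1)) (rh' (inord 2)).
have [c0 c1 c2] := And3 (rh'' (inord 0)) (rh'' (inord 1)) (rh'' (inord 2)).
by rewrite /br; lreg.
Qed.

Lemma vregular_cross h h' : vregular U h -> vregular U h' ->
  vregular U (fun x => cross (h x) (h' x)).
Proof.
move=> rh rh' k; have -> : k = inord k by rewrite inord_val.
have [a0 a1 a2] := And3 (rh (inord 0)) (rh (inord 1)) (rh (inord 2)).
have [b0 b1 b2] := And3 (rh' (inord 0)) (rh' (inord 1)) (rh' (inord 2)).
case: k => [[|[|[|]]] ?] //=.
- apply: (@lregular_ext _ _ _ (fun x => x1 (h x) * x2 (h' x) - x2 (h x) * x1 (h' x))); last by lreg.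
  by move=> x _; have [-> _ _] := crossE (h x) (h' x).
- apply: (@lregular_ext _ _ _ (fun x => x2 (h x) * x0 (h' x) - x0 (h x) * x2 (h' x))); last by lreg.
  by move=> x _; have [_ -> _] := crossE (h x) (h' x).
- apply: (@lregular_ext _ _ _ (fun x => x0 (h x) * x1 (h' x) - x1 (h x) * x0 (h' x))); last by lreg.
  by move=> x _; have [_ _ ->] := crossE (h x) (h' x).
Qed.

Lemma vregular_vec3 h h' h'' : lregular U h -> lregular U h' -> lregular U h'' ->
  vregular U (fun x => vec3 (h x) (h' x) (h'' x)).
Proof.
move=> rh rh' rh'' k; apply: (@lregular_ext _ _ _ (fun x => [:: h x; h' x; h'' x]`_k)).
  by move=> x _; rewrite mxE.
by case: k => [[|[|[|]]] ?].
Qed.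

Lemma vregular_of_pentagon (N : car X -> pentagon K) :
  (forall i, vregular U (fun x => N x i)) ->
  forall a, vregular U (fun x => of_pentagon (N x) a).
Proof. by move=> rN [i|r] //=; do ![apply: vregular_cross]. Qed.

End Regular.

Lemma coord_R5 L (i : 'Z_5) (k : 'I_3) :
  Defs.coord (q := R5 K) L 0 (lshift _ (mxvec_index (i : 'I_5) k)) = L (inl i) 0 k /\
  Defs.coord (q := R5 K) L 0 (rshift _ (mxvec_index (i : 'I_5) k)) = L (inr i) 0 k.
Proof. by split; rewrite /= ?row_mxEl ?row_mxEr mxvecE mxE. Qed.

Lemma vregular_R5 (U : car (R5 K) -> Prop) i : vregular U (fun L => L (inl i)).
Proof.
move=> k; apply: lregular_ext (lregular_coord (U := U) (lshift _ (mxvec_index (i : 'I_5) k))) => L _.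
by have [-> _] := coord_R5 L i k.
Qed.

Definition chart_of_real (L : label -> 'rV[K]_3) : 'rV[K]_2 :=
  plane_vec (pent_xy (fun i => L (inl i))).
Definition real_of_chart (e : 'rV[K]_2) : label -> 'rV[K]_3 :=
  of_pentagon (normal_pentagon (plane_pt e)).
Definition real_plane (e : 'rV[K]_2) : Prop := realization (real_of_chart e).

Lemma arr_equiv_inl L L' : arr_equiv L L' ->
  arr_equiv (fun i => L (inl i)) (fun i => L' (inl i)).
Proof. by case=> g ug LL'; exists g. Qed.

Lemma real_of_chart_iso L : realization L -> arr_equiv L (real_of_chart (chart_of_real L)).
Proof.
move=> rL; have [_ _ tr] := arr_equiv_equivalence K label.
apply: tr (realization_of_pentagon rL) _; rewrite /real_of_chart /chart_of_real plane_vecK.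
exact/of_pentagon_equiv/normal_pentagon_equiv/realization_general_position.
Qed.

Lemma chart_of_realK e : chart_of_real (real_of_chart e) = e.
Proof. by rewrite /chart_of_real /= pent_xy_normal plane_ptK. Qed.

Lemma vregular_real_of_chart (U : car (plane K) -> Prop) a :
  vregular U (fun e => real_of_chart e a).
Proof.
have [rx ry] := lregular_plane U.
apply: vregular_of_pentagon => i; rewrite /normal_pentagon.
by case: i => [[|[|[|[|[|]]]]] ?] //=; apply: vregular_vec3; lreg.
Qed.

Definition distinct3 (t : label * label * label) : bool :=
  let: (a, b, c) := t in [&& a != b, b != c, a != c & ~~ nonbasis3 a b c].

Definition bases_prod (e : 'rV[K]_2) : K :=
  \prod_(t : label * label * label | distinct3 t)
     br (real_of_chart e t.1.1) (real_of_chart e t.1.2) (real_of_chart e t.2).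

(** The five additional lines pass through the required double points. *)
Lemma of_pentagon_nonbasis N a b c : a != b -> b != c -> a != c ->
  nonbasis3 a b c -> br (of_pentagon N a) (of_pentagon N b) (of_pentagon N c) = 0.
Proof.
have key (i j r : 'Z_5) : i != j -> i + j + r == 0 ->
    br (N i) (N j) (of_pentagon N (inr r)) = 0.
  move=> ij /eqP s /=; set m := 2 * r.
  have z5 : 5%:R = 0 :> 'Z_5 by exact: val_inj.
  (* The labels i and j are symmetric about m, because i + j = - r = 2 m modulo 5. *)
  have [t ti tj] : exists2 t, i = m + t & j = m - t.
    exists (i - m); first by rewrite addrC subrK.
    apply/eqP; rewrite -subr_eq0; apply/eqP.
    transitivity (i + j + r - 5%:R * r); first by rewrite /m; ring.
    by rewrite s z5 mul0r subr0.
  have t0 : t != 0 by apply: contraNneq ij => t0; rewrite ti tj t0 subr0 addr0.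
  have : t = 1 \/ t = -1 \/ t = 2 \/ t = -2.
    case: (t) t0 => [[|[|[|[|[|]]]]] ?] // _; [left|right;right;left|right;right;right|right;left];
      exact: val_inj.
  rewrite ti tj; case=> [->|[->|[->|->]]]; rewrite ?opprK.
  - exact: br_meet1.
  - by rewrite brC br_meet1 oppr0.
  - exact: br_meet2.
  - by rewrite brC br_meet2 oppr0.
case: a b c => [i|i] [j|j] [k|k] //= ab bc ac s.
- exact: key.
- by rewrite brC br_rot; apply/eqP; rewrite oppr_eq0; apply/eqP; apply: key.
- by rewrite br_rot; apply: key.
Qed.

(** Being a realization is an open condition: the incidences hold by construction. *)
Lemma real_planeE e : real_plane e <-> bases_prod e != 0.
Proof.
rewrite /real_plane realization_br; split=> [H|/prodf_neq0 H a b c ab bc ac].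
  apply/prodf_neq0 => -[[a b] c] /and4P[ab bc ac nb] /=.
  by rewrite H.
case: (boolP (nonbasis3 a b c)) => nb; last first.
  by apply/negbTE; apply: (H (a, b, c)); rewrite /= ab bc ac.
by apply/eqP; apply: of_pentagon_nonbasis.
Qed.

Lemma zopen_real_plane : zopen (X := plane K) real_plane.
Proof.
apply: (zopen_ext _ (@zopen_neq0 _ (plane K) _ bases_prod (zopen_pts (plane K)) _ _)).
- by move=> e; split=> [[_ h]|h]; [exact/real_planeE | split=> //; exact/real_planeE].
- apply: (@lregular_ext _ (plane K) (@pts _ (plane K)) (fun e =>
    \prod_(t : label * label * label) if distinct3 t then
     br (real_of_chart e t.1.1) (real_of_chart e t.1.2) (real_of_chart e t.2) else 1)).
    by move=> e _; rewrite -big_mkcond.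
  apply: lregular_prod => t; case: (distinct3 t); last exact: lregularC.
  by apply: lregular_br; apply: vregular_real_of_chart.
- by move=> e e' _ _ ->.
Qed.

Lemma chart_of_real_morphism :
  is_morphism (X := R5 K) (Y := plane K) (@realization K) real_plane chart_of_real.
Proof.
apply: lregular_morphism => //.
- exact: zopen_pts.
- by move=> L rL; exact: realization_equiv (real_of_chart_iso rL) rL.
- move=> L L' rL rL' LL'; rewrite /= /chart_of_real.
  by rewrite (pent_xy_equiv (realization_general_position rL) (arr_equiv_inl LL')).
have rb i j k (ij : i != j) (jk : j != k) (ik : i != k) :
    lregular (X := R5 K) (@realization K) (fun L => br (L (inl i)) (L (inl j)) (L (inl k))) /\
    lregular (X := R5 K) (@realization K) (fun L => (br (L (inl i)) (L (inl j)) (L (inl k)))^-1).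
  have r : lregular (X := R5 K) (@realization K) (fun L => br (L (inl i)) (L (inl j)) (L (inl k))).
    by apply: lregular_br; apply: vregular_R5.
  split=> //; apply: lregularV => // L rL.
  exact: (realization_general_position rL).
have [a1 _] := rb 4 1 2 isT isT isT; have [a2 _] := rb 0 1 3 isT isT isT.
have [_ a3] := rb 3 1 2 isT isT isT; have [_ a4] := rb 0 1 4 isT isT isT.
have [a5 _] := rb 0 4 2 isT isT isT; have [_ a6] := rb 0 3 2 isT isT isT.
have [ru rv] : lregular (X := R5 K) (@realization K) (fun L => (pent_xy (fun i => L (inl i))).1) /\
    lregular (X := R5 K) (@realization K) (fun L => (pent_xy (fun i => L (inl i))).2).
  split.
    apply: (@lregular_ext _ (R5 K) _ (fun L => br (L (inl 4)) (L (inl 1)) (L (inl 2)) *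
      br (L (inl 0)) (L (inl 1)) (L (inl 3)) * ((br (L (inl 3)) (L (inl 1)) (L (inl 2)))^-1 *
      (br (L (inl 0)) (L (inl 1)) (L (inl 4)))^-1))); last by lreg.
    by move=> L _; rewrite -invfM.
  apply: (@lregular_ext _ (R5 K) _ (fun L => br (L (inl 0)) (L (inl 4)) (L (inl 2)) *
      br (L (inl 0)) (L (inl 1)) (L (inl 3)) * ((br (L (inl 0)) (L (inl 3)) (L (inl 2)))^-1 *
      (br (L (inl 0)) (L (inl 1)) (L (inl 4)))^-1))); last by lreg.
  by move=> L _; rewrite -invfM.
move=> i; have [i0|i0] := boolP (i == ord0).
  by apply: lregular_ext ru => L _; rewrite /= /chart_of_real mxE i0.
by apply: lregular_ext rv => L _; rewrite /= /chart_of_real mxE (negPf i0).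
Qed.

Lemma real_of_chart_morphism :
  is_morphism (X := plane K) (Y := R5 K) real_plane (@realization K) real_of_chart.
Proof.
apply: lregular_morphism => //.
- exact: zopen_real_plane.
- by move=> e e' _ _ ->; have [refl _ _] := arr_equiv_equivalence K label; apply: refl.
move=> i; case: (split_ordP i) => [j ->|j ->]; case/mxvec_indexP: j => j k.
  apply: lregular_ext (@vregular_real_of_chart real_plane (inl j) k) => e _.
  by have [-> _] := coord_R5 (real_of_chart e) j k.
apply: lregular_ext (@vregular_real_of_chart real_plane (inr j) k) => e _.
by have [_ ->] := coord_R5 (real_of_chart e) j k.
Qed.

End Chart.

(** * A realization, and birationality *)

(** The arrangement with parameters (2, 3), in integers. *)
Definition sample_lines (a : label) : int * int * int :=
  match a with
  | inl i => nth (0, 0, 0)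
      [:: (1, 0, 0); (0, 1, 0); (0, 0, 1); (1, 1, 1); (2, 3, 1)] (i : 'I_5)
  | inr r => nth (0, 0, 0)
      [:: (2, 2, 1); (-1, -3, -1); (0, 1, 1); (1, 0, 2); (-2, -3, 0)] (r : 'I_5)
  end.

Definition brz (u v w : int * int * int) : int :=
  u.1.1 * (v.1.2 * w.2 - v.2 * w.1.2) + u.1.2 * (v.2 * w.1.1 - v.1.1 * w.2)
    + u.2 * (v.1.1 * w.1.2 - v.1.2 * w.1.1).

Definition all_labels : seq label :=
  let z5 : seq 'Z_5 := [:: 0; 1; 2; 3; 4] in map inl z5 ++ map inr z5.

Lemma mem_all_labels a : a \in all_labels.
Proof. by case: a => [[[|[|[|[|[|]]]]] ?]|[[|[|[|[|[|]]]]] ?]]. Qed.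

Lemma sample_bases (a b c : label) : distinct3 (a, b, c) ->
  brz (sample_lines a) (sample_lines b) (sample_lines c) != 0.
Proof.
have : all (fun a => all (fun b => all (fun c => distinct3 (a, b, c) ==>
    (brz (sample_lines a) (sample_lines b) (sample_lines c) != 0))
    all_labels) all_labels) all_labels by vm_compute.
move=> /allP/(_ a (mem_all_labels a))/allP/(_ b (mem_all_labels b)).
by move=> /allP/(_ c (mem_all_labels c))/implyP.
Qed.

Section Sample.
Variable K : fieldType.
Hypothesis charK0 : [pchar K] =i pred0.

Lemma sample_linesE a : real_of_chart (plane_vec (2, 3)) a =
  vec3 (sample_lines a).1.1%:~R (sample_lines a).1.2%:~R (sample_lines a).2%:~R :> 'rV[K]_3.
Proof.
rewrite /real_of_chart plane_vecK.
have crv (x y z x' y' z' : K) : cross (vec3 x y z) (vec3 x' y' z') =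
    vec3 (y * z' - z * y') (z * x' - x * z') (x * y' - y * x').
  have [e0 e1 e2] := crossE (vec3 x y z) (vec3 x' y' z').
  have [f0 f1 f2] := vec3E x y z; have [g0 g1 g2] := vec3E x' y' z'.
  have [h0 h1 h2] := vec3E (y * z' - z * y') (z * x' - x * z') (x * y' - y * x').
  by apply: row3P; rewrite ?e0 ?e1 ?e2 ?h0 ?h1 ?h2 ?f0 ?f1 ?f2 ?g0 ?g1 ?g2.
case: a => [[[|[|[|[|[|]]]]] ?]|[[|[|[|[|[|]]]]] ?]] //;
  rewrite /= /normal_pentagon /= ?crv; congr vec3; ring.
Qed.

Lemma real_plane_inhabited : real_plane (plane_vec (2, 3) : 'rV[K]_2).
Proof.
have int_neq0 (z : int) : z != 0 -> z%:~R != 0 :> K.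
  move/pcharf0P: charK0 => c0; case: z => n z0; first by rewrite -pmulrn c0.
  by rewrite NegzE rmorphN /= oppr_eq0 -pmulrn c0.
apply/real_planeE/prodf_neq0 => -[[a b] c] /sample_bases/int_neq0.
rewrite !sample_linesE br_vec3 /brz.
by apply: contraNneq => <-; rewrite !(rmorphD, rmorphB, rmorphM) /=; apply/eqP; ring.
Qed.

End Sample.

Section Birational.
Variable K : closedFieldType.
Hypothesis charK0 : [pchar K] =i pred0.

Lemma birational_R5_plane : birational (R5 K) (plane K).
Proof.
exists (@realization K), (@real_plane K); split.
- by split=> [|O [Op _ _] [L OL]]; [exact: zopen_pts | exists L => //; exact: Op].
- by apply: plane_dense (real_plane_inhabited charK0); exact: zopen_real_plane.
exists (@chart_of_real K), (@real_of_chart K); split.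
- exact: chart_of_real_morphism.
- exact: real_of_chart_morphism.
- move=> L rL; have [_ sym _] := arr_equiv_equivalence K label.
  exact/sym/real_of_chart_iso.
- by move=> e _; exact: chart_of_realK.
Qed.

Lemma proj_variety_equivalence n (I : {mpoly K[n]} -> Prop) :
  RelationClasses.Equivalence (@eqv K (proj_variety I)).
Proof.
split=> [v|v w [c c0 ->]|u v w [c c0 ->] [d d0 ->]].
- by exists 1; rewrite ?oner_neq0 ?scale1r.
- by exists c^-1; rewrite ?invr_neq0 // scalerA mulVf ?scale1r.
- by exists (d * c); rewrite ?mulf_neq0 // scalerA.
Qed.

Lemma compactification_birational X n (I : {mpoly K[n]} -> Prop) :
  compactification X I -> birational X (proj_variety I).
Proof.
case=> _ [W dW iso]; exists (@pts K X), W; split=> //.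
by split=> [|O [Op _ _] [x Ox]]; [exact: zopen_pts | exists x => //; exact: Op].
Qed.

End Birational.

(* The elliptic modular surface is the projective variety defined by I, which
   contains the surface of triples as a dense open subset; its smoothness and
   minimality are not needed, so every projective compactification is allowed. *)
Theorem theorem21 (K : closedFieldType) (charK0 : [pchar K] =i pred0) :
  (forall (n : nat) (I : {mpoly K[n]} -> Prop),
     compactification (Xi1_5_open K) I ->
     birational (R5 K) (proj_variety I)) /\
  (exists2 U : car (Xi1_5_open K) -> Prop, dense_open U &
     forall T : triple K, U T ->
       arr_equiv (Psi (triple_points T)) (triple_points (triple_mulN2 T))).
Proof.
split=> [n I cI|]; last exact: Psi_mulN2.
have eqR := arr_equiv_equivalence K label.
have eqX := triple_iso_equivalence K.
have eqP := plane_equivalence K.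
have eqV := proj_variety_equivalence I.
apply: (@birational_trans _ (R5 K) (Xi1_5_open K)) => //; last exact: compactification_birational cI.
apply: (@birational_trans _ (R5 K) (plane K)) => //; first exact: birational_R5_plane.
exact/birational_sym/birational_Xi1_5_plane.
Qed.
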